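(* Let $H\neq\{0\}$ be a separable (real) Hilbert space. Then $N_{H,2}=2$.
   Context: $H$ (finite- or infinite-dimensional) has inner product $(\cdot\mid\cdot)$ and induced norm $|\cdot|$. $\mathcal{P}_2(H)$ is the set of Borel probability measures $\mu$ on $H$ with $\int_H|\xi|^2\mu(d\xi)<+\infty$, and $\mathcal{W}_2$ is the $L^2$-Wasserstein distance on $\mathcal{P}_2(H)$. For $\mu\in\mathcal{P}_2(H)$, $N\ge1$ and $(x_1,\dots,x_N)\in H^N$, $e_{N,2}(\mu,(x_1,\dots,x_N))=\big[\int_H\min_{1\le i\le N}|\xi-x_i|^2\,\mu(d\xi)\big]^{1/2}$. $N_{H,2}$ is the smallest $N\in\mathbb{N}^*$ such that both of the following hold: (1) for all $\mu,\nu\in\mathcal{P}_2(H)$, if $e_{N,2}(\mu,\cdot)=e_{N,2}(\nu,\cdot)+C$ on $H^N$ for some real constant $C$, then $\mu=\nu$ (and $C=0$); (2) for all $\mu_n$ ($n\ge1$), $\mu_\infty\in\mathcal{P}_2(H)$, if $e_{N,2}(\mu_n,\cdot)\to e_{N,2}(\mu_\infty,\cdot)$ pointwise on $H^N$, then $\mathcal{W}_2(\mu_n,\mu_\infty)\to0$. *)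

(* Defs.v *)
From HB Require Import structures.
From mathcomp Require Import all_boot all_order all_algebra.
From mathcomp Require Import all_classical all_reals all_analysis.

Set Implicit Arguments.
Unset Strict Implicit.
Unset Printing Implicit Defensive.

Import Order.TTheory GRing.Theory Num.Theory.
Import numFieldNormedType.Exports.

Local Open Scope classical_set_scope.
Local Open Scope ring_scope.
Local Open Scope ereal_scope.

(* T with its Borel sigma-algebra.  As a type this is just T. *)
Notation borelType T := (g_sigma_algebraType (@open T)).

Definition separable (T : topologicalType) : Prop :=
  exists2 D : set T, countable D & dense D.

(* For dot a symmetric positive definite bilinear form, this makes the complete
   normed module H a real Hilbert space. *)
Definition is_inner_product (R : realType) (H : completeNormedModType R)
    (dot : {dot H for @idfun R}) : Prop :=
  forall x : H, dot x x = (`|x| ^+ 2)%R.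

Section Quantization.
Variables (R : realType) (H : completeNormedModType R).

Definition P2 (mu : probability (borelType H) R) : Prop :=
  \int[mu]_xi ((`|xi : H| ^+ 2)%R)%:E < +oo.

(* A measure is a function on all sets, but only its values on measurable
   sets are meaningful, so measures are compared on Borel sets only. *)
Definition eq_measure (mu nu : probability (borelType H) R) : Prop :=
  forall A : set (borelType H), measurable A -> mu A = nu A.

(* The quantization error e_{N,2}(mu, x), with values in \bar R (it is finite
   when mu is in P2 and 0 < N).  The default value +oo of the minimum
   only matters when N = 0. *)
Definition qerror (N : nat) (mu : probability (borelType H) R)
    (x : 'I_N -> H) : \bar R :=
  sqrte (\int[mu]_xi \big[mine/+oo]_(i < N) ((`|(xi : H) - x i| ^+ 2)%R)%:E).

(* Couplings live on the product of the Borel sigma-algebras, which is the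
   Borel sigma-algebra of H * H when H is separable. *)
Definition coupling (mu nu : probability (borelType H) R)
    (gamma : probability (borelType H * borelType H)%type R) : Prop :=
  forall A : set (borelType H), measurable A ->
    gamma (A `*` setT) = mu A /\ gamma (setT `*` A) = nu A.

Definition wasserstein2 (mu nu : probability (borelType H) R) : \bar R :=
  sqrte (ereal_inf
    [set \int[gamma]_z ((`|(z.1 : H) - (z.2 : H)| ^+ 2)%R)%:E
      | gamma in coupling mu nu]).

Definition characterizes_measures (N : nat) : Prop :=
  forall (mu nu : probability (borelType H) R) (C : R), P2 mu -> P2 nu ->
    (forall x : 'I_N -> H, qerror mu x = qerror nu x + C%:E) ->
    eq_measure mu nu /\ C = 0%R.

Definition characterizes_convergence (N : nat) : Prop :=
  forall (mu_ : nat -> probability (borelType H) R)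
    (mu : probability (borelType H) R), (forall n, P2 (mu_ n)) -> P2 mu ->
    (forall x : 'I_N -> H, qerror (mu_ n) x @[n --> \oo] --> qerror mu x) ->
    wasserstein2 (mu_ n) mu @[n --> \oo] --> 0.

Definition admissible_level (N : nat) : Prop :=
  [/\ (0 < N)%N, characterizes_measures N & characterizes_convergence N].

(* N_{H,2} = N.  Given as a relation, since the existence of an admissible
   level is itself part of the claim that N_{H,2} has a given value. *)
Definition is_NH2 (N : nat) : Prop :=
  admissible_level N /\ forall M : nat, admissible_level M -> (N <= M)%N.

End Quantization.

(* Main.v *)
Require Import Defs.
From HB Require Import structures.
From mathcomp Require Import all_boot all_order all_algebra.
From mathcomp Require Import all_classical all_reals all_analysis.
From mathcomp Require Import measurable_realfun.
From mathcomp Require Import ring lra.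

Import Order.TTheory GRing.Theory Num.Theory.
Import numFieldNormedType.Exports.

Local Open Scope classical_set_scope.
Local Open Scope ring_scope.

(** Level 1 only sees the mean and the second moment.  At level 2,
    [min(|x-a|^2, |x-b|^2) = |x-a|^2 - 2 ((x|u) - t)^+] for suitable [u], [t],
    so [e_{2,2}] gives the second moment and the integrals of all the functions
    [((x|u) - t)^+], hence, by piecewise affine approximation, those of all
    trigonometric polynomials of [x].

    To bound [W_2(mu_n, mu)], cover most of [mu] by small balls centred at
    [d_0, ..., d_(k-1)], and take a finite partition of unity [F_i] by
    trigonometric polynomials (products of Bernstein weights in
    [(2 + sin((x|d_j)/L))/4]) such that every [(.|d_j)] is almost constant on
    each cell.  For [lam < 1] and [n] large, [lam mu(F_i) <= mu_n(F_i)], and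
    the density [lam sum_i F_i(x) F_i(y) / mu_n(F_i) + r(x)] with respect to
    [mu_n (x) mu] defines a coupling.  Since
    [|x-y|^2 / 2 + |y|^2 <= |x|^2 + 2 |(x-y|v)| + 2 |y-v|^2] with [v] the
    [d_j] nearest to [y], the convergence of the second moments makes its cost
    small.

    The uniqueness statement follows by applying this to a constant sequence. *)

(** * Trigonometric and piecewise affine estimates *)

(** Young's inequality: the gap between the two sides is [(|z| - c)^2 / (2c)]. It trades an absolute
    deviation for a squared one, which a variance identity can control. *)
Lemma le_mean_square {R : realFieldType} (c z : R) :
  0 < c -> `|z| <= c / 2 + z ^+ 2 / (2 * c).
Proof.
move=> c0; rewrite -(real_normK (num_real z)).
have -> : c / 2 + `|z| ^+ 2 / (2 * c) = `|z| + (`|z| - c) ^+ 2 / (2 * c).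
  by field; rewrite gt_eqF.
by rewrite lerDl divr_ge0 ?sqr_ge0// mulr_ge0// ltW.
Qed.

Section trigonometric_estimates.
Context {R : realType}.
Implicit Types x y : R.

Lemma ler_norm_cosB x y : `|cos x - cos y| <= `|x - y|.
Proof.
wlog xy : x y / x <= y.
  move=> h; have [/h//|/ltW/h] := leP x y.
  by rewrite distrC [`|y - x|]distrC.
have [c _] := @MVT_segment R cos (fun z => - sin z) x y xy
  (fun z _ => is_derive_cos z) (continuous_subspaceT (@continuous_cos R)).
rewrite distrC => ->; rewrite normrM normrN [`|x - y|]distrC.
by rewrite ler_piMl// sin_max.
Qed.

(** By the mean value theorem the difference is [(1 - cos c) x] with [c] between 0 and [x], and
    [cos] is 1-Lipschitz. After rescaling, [L sin (z / L)] replaces [z] up to [z^2 / L]. *)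
Lemma ler_norm_Bsin x : `|x - sin x| <= x ^+ 2.
Proof.
wlog x0 : x / 0 <= x.
  move=> h; have [/h//|/ltW] := leP 0 x.
  rewrite -oppr_ge0 => /h; rewrite sinN sqrrN -opprD normrN //.
have dB (z : R) : is_derive z 1 (fun z => z - sin z) (1 - cos z).
  exact: is_deriveB.
have cB : continuous (fun z : R => z - sin z).
  by move=> z; apply: cvgB; [exact: cvg_id|exact: continuous_sin].
have [c] := @MVT_segment R _ _ 0 x x0 (fun z _ => dB z)
  (continuous_subspaceT cB).
rewrite in_itv/= => /andP[c0 cx].
rewrite sin0 !subr0 => ->; rewrite normrM expr2 ler_pM//.
rewrite -cos0 (le_trans (ler_norm_cosB _ _))// sub0r normrN !ger0_norm//.
by rewrite ger0_norm.
Qed.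

End trigonometric_estimates.

Section piecewise_affine.
Context {R : realType}.

(** The continuous piecewise affine functions with finitely many kinks that are constant near minus
    infinity. *)
Inductive hinge_span : (R -> R) -> Prop :=
| hinge_cst c : hinge_span (fun=> c)
| hinge_max t : hinge_span (fun x => Num.max (x - t) 0)
| hingeD f g : hinge_span f -> hinge_span g -> hinge_span (fun x => f x + g x)
| hingeZ c f : hinge_span f -> hinge_span (fun x => c * f x).

(** Induction on the number of nodes: a difference of two hinges at consecutive nodes is a ramp,
    constant beyond the second node, which corrects the interpolant there and leaves its past
    unchanged. On one mesh cell both the interpolant and [g] vary by at most [h]. *)
Lemma hinge_interpolation (g : R -> R) (a h : R) (m : nat) : 0 < h ->
  (forall x y, `|g x - g y| <= `|x - y|) ->
  exists f, [/\ hinge_span f,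
    forall x, x <= a -> f x = g a,
    forall x, a <= x <= a + m%:R * h -> `|f x - g x| <= 2 * h &
    forall x, a + m%:R * h <= x -> f x = g (a + m%:R * h)].
Proof.
move=> h0 gL; elim: m => [|m [f [fH fl fm fr]]].
  exists (fun=> g a); split => [|//||].
  - exact: hinge_cst.
  - move=> x; rewrite mul0r addr0 -eq_le => /eqP ->.
    by rewrite subrr normr0 mulr_ge0// ltW.
  - by move=> x _; rewrite mul0r addr0.
set b := a + m%:R * h; set c := a + m.+1%:R * h.
have bc : c = b + h by rewrite /b /c -natr1; ring.
have ab : a <= b by rewrite lerDl mulr_ge0// ltW.
pose D := (g c - g b) / h.
exists (fun x => f x + D * (Num.max (x - b) 0 + (-1) * Num.max (x - c) 0)).
have gbc : `|g c - g b| <= h.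
  by rewrite (le_trans (gL _ _))// bc addrAC subrr add0r gtr0_norm.
split.
- apply: hingeD => //; apply: hingeZ; apply: hingeD; first exact: hinge_max.
  by apply: hingeZ; exact: hinge_max.
- move=> x xa; rewrite fl// !max_r ?subr_le0; [|lra|lra].
  by rewrite mulr0 addr0 mulr0 addr0.
- move=> x /andP[ax xc]; rewrite [Num.max (x - c) 0]max_r ?subr_le0//.
  rewrite mulr0 addr0; have [xb|/ltW bx] := leP x b.
    by rewrite max_r ?subr_le0// mulr0 addr0 fm// ax.
  rewrite max_l ?subr_ge0// fr// -/b.
  rewrite (_ : _ - g x = (g c - g b) * ((x - b) / h) + (g b - g x)); last first.
    by rewrite /D; ring.
  rewrite (le_trans (ler_normD _ _))// mulr_natl mulr2n lerD//.
    rewrite normrM -[leRHS]mulr1; apply: ler_pM => //.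
    rewrite ger0_norm; last by rewrite divr_ge0 ?subr_ge0// ltW.
    by rewrite ler_pdivrMr// mul1r; lra.
  rewrite (le_trans (gL _ _))// distrC ger0_norm ?subr_ge0//; lra.
- move=> x cx; rewrite fr -/b; last lra.
  rewrite !max_l ?subr_ge0//; last lra.
  by rewrite /D bc; field; rewrite gt_eqF.
Qed.

Lemma hinge_approx (g : R -> R) (e : R) : 0 < e ->
  (forall x, `|g x| <= 1) -> (forall x y, `|g x - g y| <= `|x - y|) ->
  exists2 f, hinge_span f & forall x, `|f x - g x| <= e * (1 + x ^+ 2).
Proof.
(* [L] is at least 1 and at least [2 / e], so [e L^2 >= 2] and outside [[-L, L]] the trivial bound 2
   on the difference suffices. The mesh [h = 2 L / m] is then taken so fine that [2 h <= e]. *)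
move=> e0 g1 gL; pose L := 1 + 2 / e.
have L1 : 1 <= L by rewrite lerDl divr_ge0// ltW.
have L0 : 0 < L by apply: lt_le_trans L1.
pose m := Num.bound (4 * L / e).
have m0 : 0 < m%:R :> R.
  by rewrite (lt_trans _ (archi_boundP _)) ?divr_gt0 ?divr_ge0 ?mulr_ge0 ?mulr_gt0// ltW.
have hm : 4 * L / e < m%:R by apply: archi_boundP; rewrite divr_ge0 ?mulr_ge0 ?ltW.
pose h := 2 * L / m%:R.
have h0 : 0 < h by rewrite divr_gt0 ?mulr_gt0.
have [f [fH fl fm fr]] := hinge_interpolation g (- L) h m h0 gL.
have mh : - L + m%:R * h = L by rewrite /h; field; rewrite gt_eqF.
rewrite mh in fm fr.
have far x : L ^+ 2 <= x ^+ 2 -> 2 <= e * (1 + x ^+ 2).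
  move=> Lx; rewrite -ler_pdivrMl// mulrC.
  apply: le_trans (_ : L ^+ 2 <= _); last by rewrite (le_trans Lx)// lerDr.
  rewrite (@le_trans _ _ L)//; first by rewrite /L; lra.
  by rewrite expr2 ler_peMl// ltW.
exists f => // x.
have [xL|Lx] := leP x (- L).
  rewrite fl// (le_trans (ler_normB _ _))// (le_trans (lerD (g1 _) (g1 _)))//.
  rewrite (le_trans _ (far x _))//; nra.
have [xL|/ltW Lx'] := leP x L.
  rewrite (le_trans (fm _ _)) ?(ltW Lx)//.
  rewrite (@le_trans _ _ e)//; last by rewrite ler_peMr ?lerDl ?sqr_ge0// ltW.
  rewrite /h mulrA ler_pdivrMr//; move: hm; rewrite ltr_pdivrMr// => hm; lra.
rewrite fr// (le_trans (ler_normB _ _))// (le_trans (lerD (g1 _) (g1 _)))//.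
rewrite (le_trans _ (far x _))//; nra.
Qed.

End piecewise_affine.

(* An algebraic form of the Bernstein weights 'C(M, v) t^v (1 - t)^(M - v):
   the index set is {0,1}^M and v counts the ones. *)
Lemma bernstein_partition {R : realDomainType} {T : Type} (t : T -> R)
    (A : (T -> R) -> Prop) (M : nat) :
  A (fun=> 1) -> (forall f, A f -> A (fun x => f x * t x)) ->
  (forall f, A f -> A (fun x => f x * (1 - t x))) ->
  forall r, 0 < r -> (forall x, r <= t x <= 1 - r) ->
  exists (I : finType) (F : I -> T -> R) (v : I -> R),
    [/\ forall i, A (F i), forall i x, r ^+ M <= F i x,
        forall x, \sum_i F i x = 1 &
        forall x, \sum_i F i x * (v i - M%:R * t x) ^+ 2
                  = M%:R * (t x * (1 - t x))].
Proof.
move=> A1 At A1t r r0 tr; elim: M => [|M [I [F [v [FA F0 F1 Fv]]]]].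
  exists unit, (fun _ _ => 1), (fun=> 0); split => // x.
    by rewrite sumr_const card_unit.
  by rewrite big1 => [|_ _]; ring.
exists (I * bool)%type,
  (fun p x => F p.1 x * (if p.2 then t x else 1 - t x)),
  (fun p => v p.1 + (p.2 : bool)%:R).
have sumE (G : I * bool -> R) :
    \sum_p G p = \sum_i (G (i, true) + G (i, false)).
  rewrite (eq_bigr (fun p => G (p.1, p.2))); last by case.
  rewrite -(pair_bigA _ (fun i b => G (i, b)))/=.
  by apply: eq_bigr => i _; rewrite big_bool.
split.
- by move=> [i []] /=; [exact: At | exact: A1t].
- move=> [i b] x /=; have /andP[? ?] := tr x; have r0' := ltW r0.
  by rewrite exprSr; apply: ler_pM => //; [exact: exprn_ge0|case: b; lra].
- move=> x; rewrite sumE -[RHS](F1 x); apply: eq_bigr => i _ /=; ring.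
- move=> x; rewrite sumE/=.
  (* The variance grows by that of one more Bernoulli variable of parameter [t x]: the cross terms
     of the two values of the new bit cancel. *)
  rewrite (eq_bigr (fun i => F i x * (v i - M%:R * t x) ^+ 2
                             + F i x * (t x * (1 - t x)))); last first.
    by move=> i _; rewrite -natr1; ring.
  rewrite big_split/= Fv -big_distrl/= F1 -natr1; ring.
Qed.

(** * Inner products and functions of quadratic growth *)

Section inner_product.
Context {R : realType} {H : completeNormedModType R}.
Context (dot : {dot H for @idfun R}) (dot_norm : is_inner_product dot).
Implicit Types x y u v : H.

Lemma dotC x y : dot x y = dot y x.
Proof. by rewrite hermC expr0 mul1r. Qed.

Lemma dotDr x y z : dot x (y + z) = dot x y + dot x z.
Proof. exact: linearDr. Qed.

Lemma dotDl x y z : dot (x + y) z = dot x z + dot y z.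
Proof. by rewrite dotC dotDr !(dotC z). Qed.

Lemma dotZr a x y : dot x (a *: y) = a * dot x y.
Proof. exact: linearZr_LR. Qed.

Lemma dotZl a x y : dot (a *: x) y = a * dot x y.
Proof. by rewrite dotC dotZr dotC. Qed.

Lemma dotNr x y : dot x (- y) = - dot x y.
Proof. by rewrite -scaleN1r dotZr mulN1r. Qed.

Lemma dotNl x y : dot (- x) y = - dot x y.
Proof. by rewrite dotC dotNr dotC. Qed.

Lemma dotBr x y z : dot x (y - z) = dot x y - dot x z.
Proof. by rewrite dotDr dotNr. Qed.

Lemma dotBl x y z : dot (x - y) z = dot x z - dot y z.
Proof. by rewrite dotDl dotNl. Qed.

Lemma dot0r x : dot x 0 = 0.
Proof. by rewrite -(scale0r 0) dotZr mul0r. Qed.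

Lemma sqr_normD x y : `|x + y| ^+ 2 = `|x| ^+ 2 + 2 * dot x y + `|y| ^+ 2.
Proof. by rewrite -!dot_norm dotDl !dotDr (dotC y x); ring. Qed.

Lemma sqr_normB x y : `|x - y| ^+ 2 = `|x| ^+ 2 - 2 * dot x y + `|y| ^+ 2.
Proof. by rewrite sqr_normD normrN dotNr mulrN. Qed.

(** Cauchy-Schwarz: after squaring and multiplying by [|y|^2], the gap is the squared norm of
    [|y|^2 x - (x|y) y]. *)
Lemma ler_norm_dot x y : `|dot x y| <= `|x| * `|y|.
Proof.
have [->|y0] := eqVneq y 0; first by rewrite dot0r !normr0 mulr0.
have y2 : 0 < `|y| ^+ 2 by rewrite exprn_gt0// normr_gt0.
rewrite -ler_sqr ?nnegrE ?mulr_ge0//.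
rewrite -(ler_pM2l y2) -subr_ge0.
have -> : `|y| ^+ 2 * (`|x| * `|y|) ^+ 2 - `|y| ^+ 2 * `|dot x y| ^+ 2
   = `| `|y| ^+ 2 *: x - dot x y *: y | ^+ 2.
  rewrite sqr_normB !normrZ dotZl dotZr !exprMn.
  by rewrite !(real_normK (num_real _)); ring.
exact: sqr_ge0.
Qed.

Lemma sqr_dot_le x y : dot x y ^+ 2 <= `|y| ^+ 2 * `|x| ^+ 2.
Proof.
rewrite -exprMn mulrC -(real_normK (num_real (dot x y))).
by rewrite lerXn2r ?nnegrE ?mulr_ge0// ler_norm_dot.
Qed.

Lemma continuous_dotl u : continuous (dot ^~ u).
Proof.
move=> x; apply/cvgrPdist_le => /= e e0.
have u0 : 0 < `|u| + 1 by rewrite ltr_wpDl.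
near=> z; rewrite -dotBl (le_trans (ler_norm_dot _ _))//.
rewrite (@le_trans _ _ (e / (`|u| + 1) * (`|u| + 1)))//; last first.
  by rewrite divfK// gt_eqF.
rewrite ler_pM// ?lerDl//; near: z.
by apply: cvgr_dist_le; rewrite ?divr_gt0//; exact: cvg_id.
Unshelve. all: by end_near. Qed.

(* |x - y|^2 = |x|^2 - |y|^2 - 2 (x - y | y); writing y = v + (y - v), the
   term (x - y | y - v) is absorbed by Young's inequality. *)
Lemma sqr_dist_le x y v :
  `|x - y| ^+ 2 / 2 + `|y| ^+ 2
  <= `|x| ^+ 2 + 2 * `|dot (x - y) v| + 2 * `|y - v| ^+ 2.
Proof.
have h1 : - dot (x - y) v <= `|dot (x - y) v| by rewrite lerNl lerNnormlW.
have h2 : 0 <= `|(x - y) + 2 *: (y - v)| ^+ 2 by exact: sqr_ge0.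
have h3 : `|x - y| ^+ 2 = `|x| ^+ 2 - `|y| ^+ 2 - 2 * dot (x - y) y.
  by rewrite sqr_normB dotBl dot_norm; ring.
rewrite sqr_normD normrZ ger0_norm// exprMn dotZr dotBr in h2.
lra.
Qed.

End inner_product.

Section quadratic_growth.
Context {R : realType} {H : completeNormedModType R}.
Implicit Types f g : H -> R.

(** The class of test functions: continuity gives Borel measurability, and the growth bound gives
    integrability under every measure in [P2]. *)
Definition quadratic_growth f :=
  continuous f /\ exists C, forall x, `|f x| <= C * (1 + `|x| ^+ 2).

Definition bounded_continuous f :=
  continuous f /\ exists C, forall x, `|f x| <= C.

Lemma quadratic_growthD f g : quadratic_growth f -> quadratic_growth g ->
  quadratic_growth (fun x => f x + g x).
Proof.
move=> [cf [C fC]] [cg [D gD]]; split.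
  by move=> x; apply: cvgD; [exact: cf|exact: cg].
exists (C + D) => x; rewrite (le_trans (ler_normD _ _))// mulrDl lerD//.
Qed.

Lemma bounded_continuousM f g : bounded_continuous f -> bounded_continuous g ->
  bounded_continuous (fun x => f x * g x).
Proof.
move=> [cf [C fC]] [cg [D gD]]; split.
  by move=> x; apply: cvgM; [exact: cf|exact: cg].
by exists (C * D) => x; rewrite normrM ler_pM.
Qed.

Lemma bounded_continuousD f g : bounded_continuous f -> bounded_continuous g ->
  bounded_continuous (fun x => f x + g x).
Proof.
move=> [cf [C fC]] [cg [D gD]]; split.
  by move=> x; apply: cvgD; [exact: cf|exact: cg].
by exists (C + D) => x; rewrite (le_trans (ler_normD _ _))// lerD.
Qed.

Lemma quadratic_growthM f g : bounded_continuous f -> quadratic_growth g ->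
  quadratic_growth (fun x => f x * g x).
Proof.
move=> [cf [C fC]] [cg [D gD]]; split.
  by move=> x; apply: cvgM; [exact: cf|exact: cg].
by exists (C * D) => x; rewrite normrM -mulrA ler_pM.
Qed.

Lemma bounded_continuous_cst (c : R) : bounded_continuous (fun=> c).
Proof. by split; [exact: cst_continuous | exists `|c|]. Qed.

Lemma bounded_growth f : bounded_continuous f -> quadratic_growth f.
Proof.
move=> [cf [C fC]]; split=> //; exists C => x.
by rewrite (le_trans (fC x))// ler_peMr ?lerDl ?sqr_ge0// (le_trans _ (fC x)).
Qed.

Lemma quadratic_growth_cst (c : R) : quadratic_growth (fun=> c).
Proof. exact/bounded_growth/bounded_continuous_cst. Qed.

Lemma quadratic_growthZ (c : R) f : quadratic_growth f ->
  quadratic_growth (fun x => c * f x).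
Proof. exact/quadratic_growthM/bounded_continuous_cst. Qed.

Lemma quadratic_growth_sum (I : finType) (F : I -> H -> R) :
  (forall i, quadratic_growth (F i)) -> quadratic_growth (fun x => \sum_i F i x).
Proof.
move=> FQ; elim: (index_enum I) => [|i s IHs].
  under eq_fun do rewrite big_nil; exact: quadratic_growth_cst.
by under eq_fun do rewrite big_cons; exact: quadratic_growthD.
Qed.

Lemma quadratic_growth_min f g : quadratic_growth f -> quadratic_growth g ->
  quadratic_growth (fun x => Num.min (f x) (g x)).
Proof.
move=> [cf [C fC]] [cg [D gD]]; split.
  by move=> x; apply: continuous_min; [exact: cf|exact: cg].
exists (C + D) => x; rewrite mulrDl; have := fC x; have := gD x.
rewrite minEle; case: ifPn => _ h1 h2.
  by rewrite (le_trans h2)// lerDl (le_trans _ h1).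
by rewrite (le_trans h1)// lerDr (le_trans _ h2).
Qed.

Lemma quadratic_growth_max f g : quadratic_growth f -> quadratic_growth g ->
  quadratic_growth (fun x => Num.max (f x) (g x)).
Proof.
move=> [cf [C fC]] [cg [D gD]]; split.
  by move=> x; apply: continuous_max; [exact: cf|exact: cg].
exists (C + D) => x; rewrite mulrDl; have := fC x; have := gD x.
rewrite maxEle; case: ifPn => _ h1 h2.
  by rewrite (le_trans h1)// lerDr (le_trans _ h2).
by rewrite (le_trans h2)// lerDl (le_trans _ h1).
Qed.

Lemma quadratic_growth_sqr_dist (a : H) :
  quadratic_growth (fun x => `|x - a| ^+ 2).
Proof.
split.
  move=> x; apply: (@continuous_comp _ _ _ (fun x => `|x - a|) (fun t => t ^+ 2)).
    apply: (@continuous_comp _ _ _ (fun x => x - a) Num.norm).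
      by apply: cvgB; [exact: cvg_id | exact: cvg_cst].
    exact: norm_continuous.
  exact: exprn_continuous.
exists (2 * (1 + `|a| ^+ 2)) => x; rewrite ger0_norm ?sqr_ge0//.
have h : `|x - a| ^+ 2 <= (`|x| + `|a|) ^+ 2.
  by rewrite lerXn2r ?nnegrE ?addr_ge0// ler_normB.
have := sqr_ge0 (`|x| - `|a|); have := sqr_ge0 (`|x| * `|a|).
rewrite exprMn; nra.
Qed.

Lemma quadratic_growth_sqr : quadratic_growth (fun x : H => `|x| ^+ 2).
Proof.
rewrite (_ : (fun _ => _) = (fun x => `|x - 0| ^+ 2)).
  exact: quadratic_growth_sqr_dist.
by apply/funext => x; rewrite subr0.
Qed.

End quadratic_growth.

(** * Trigonometric partitions of unity *)

Section trigonometric_functions.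
Context {R : realType} {H : completeNormedModType R}.
Context (dot : {dot H for @idfun R}) (dot_norm : is_inner_product dot).

(** The phase [c] lets the span of the cosines contain the constants and the sines, and makes it
    stable under products. *)
Inductive trigonometric : (H -> R) -> Prop :=
| trig_wave u c : trigonometric (fun x => cos (dot x u + c))
| trigD f g : trigonometric f -> trigonometric g ->
    trigonometric (fun x => f x + g x)
| trigZ c f : trigonometric f -> trigonometric (fun x => c * f x).

Lemma trig_cst c : trigonometric (fun=> c).
Proof.
rewrite (_ : (fun=> c) = (fun x => c * cos (dot x 0 + 0))).
  exact/trigZ/trig_wave.
by apply/funext => x; rewrite dot0r addr0 cos0 mulr1.
Qed.

(** The product of two waves is the half-sum of the waves of frequencies [u + v] and [u - v];
    bilinearity does the rest. *)
Lemma trigM f g : trigonometric f -> trigonometric g ->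
  trigonometric (fun x => f x * g x).
Proof.
move=> ft; elim: ft g => {f} [u c g gt|f1 f2 _ IH1 _ IH2 g gt|a f _ IH g gt].
- elim: gt => {g} [v d|g1 g2 _ IH1 _ IH2|a g _ IH].
  + rewrite (_ : (fun _ => _) =
        (fun x => 2^-1 * cos (dot x (u + v) + (c + d))
                  + 2^-1 * cos (dot x (u - v) + (c - d)))).
      by apply: trigD; exact/trigZ/trig_wave.
    apply/funext => x; rewrite dotDr dotBr.
    rewrite (_ : _ + _ + (c + d) = (dot x u + c) + (dot x v + d)); last ring.
    rewrite (_ : _ - _ + (c - d) = (dot x u + c) - (dot x v + d)); last ring.
    by move: (_ + c) (_ + d) => X Y; rewrite cosD cosB; field.
  + by under eq_fun do rewrite mulrDr; exact: trigD.
  + by under eq_fun do rewrite mulrCA; exact: trigZ.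
- by under eq_fun do rewrite mulrDl; apply: trigD; [exact: IH1|exact: IH2].
- by under eq_fun do rewrite -mulrA; apply: trigZ; exact: IH.
Qed.

Lemma bounded_continuous_ridge (g : R -> R) u : continuous g ->
  (exists C, forall t, `|g t| <= C) ->
  bounded_continuous (fun x : H => g (dot x u)).
Proof.
move=> cg [C gC]; split; last by exists C.
move=> x; apply: (@continuous_comp _ _ _ (dot ^~ u) g); last exact: cg.
exact: continuous_dotl.
Qed.

Lemma trig_bounded f : trigonometric f -> bounded_continuous f.
Proof.
elim => {f} [u c|f g _ fB _ gB|c f _ fB].
- apply: (bounded_continuous_ridge (fun t => cos (t + c))).
    move=> t; apply: (@continuous_comp _ _ _ (fun t => t + c) cos).
      by apply: cvgD; [exact: cvg_id|exact: cvg_cst].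
    exact: continuous_cos.
  by exists 1 => t; exact: cos_max.
- exact: bounded_continuousD.
- exact/bounded_continuousM/fB/bounded_continuous_cst.
Qed.

Lemma quadratic_growth_dot_sqr u : quadratic_growth (fun x : H => dot x u ^+ 2).
Proof.
split.
  move=> x; apply: (@continuous_comp _ _ _ (dot ^~ u) (fun t => t ^+ 2)).
    exact: continuous_dotl.
  exact: exprn_continuous.
exists (`|u| ^+ 2) => x; rewrite ger0_norm ?sqr_ge0//.
rewrite (le_trans (sqr_dot_le _ dot_norm _ _))// ler_wpM2l ?sqr_ge0//.
by rewrite lerDr.
Qed.

(* [F] localizes the value of the functions [dot ^~ u], for [u] in [V], up to
   an error which is small on average. *)
Definition localizes (V : set H) (e : R) (I : finType) (F a : I -> H -> R) :=
  [/\ forall i, trigonometric (F i) /\ (exists2 r, 0 < r & forall x, r <= F i x),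
      forall x, \sum_i F i x = 1,
      forall i, quadratic_growth (a i) /\ (forall x, 0 <= a i x),
      forall u, V u -> forall i x y, `|dot (x - y) u| <= a i x + a i y &
      forall x, \sum_i F i x * a i x <= e * (1 + `|x| ^+ 2)].

(** Up to an error [(x|u)^2 / L], the form [(x|u)] is [L sin ((x|u) / L) = 4 L t x - 2 L] with [t]
    valued in [[1/4, 3/4]]. The Bernstein weights in [t] concentrate on the cells where [v i / M] is
    close to [t x]. *)
Lemma localizes_vector (u : H) (e : R) : 0 < e ->
  exists (I : finType) (F a : I -> H -> R), localizes [set u] e I F a.
Proof.
(* The averaged error has three terms: [L] makes the sine error at most [e |x|^2], [c] makes the
   constant term [2 L c] equal to [e / 2], and [M > B] makes the variance term at most [e / 2]. *)
move=> e0; pose L := (`|u| ^+ 2 + 1) / e.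
have L0 : 0 < L by rewrite divr_gt0// ltr_wpDl.
pose c := e / (4 * L); have c0 : 0 < c by rewrite divr_gt0// mulr_gt0.
pose B := 4 * L / (c * e).
have B0 : 0 < B by rewrite divr_gt0// mulr_gt0.
pose M := Num.bound B.
have BM : B < M%:R by apply: archi_boundP; rewrite ltW.
have M0 : 0 < M%:R :> R by exact: lt_trans BM.
pose t x := (2 + sin (dot x u / L)) / 4.
have tr x : 4^-1 <= t x <= 1 - 4^-1.
  have := sin_geN1 (dot x u / L); have := sin_le1 (dot x u / L).
  rewrite /t => ? ?; apply/andP; split; lra.
have tT : trigonometric t.
  rewrite (_ : t = (fun x => 4^-1 * (2 + cos (dot x (L^-1 *: u) + - (pi / 2))))).
    by apply/trigZ/trigD; [exact: trig_cst|exact: trig_wave].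
  by apply/funext => x; rewrite cosBpihalf dotZr /t mulrC [L^-1 * _]mulrC.
have [|f fT|f fT||I [F [v [FT F0 F1 Fv]]]] :=
    bernstein_partition t trigonometric M _ _ _ (4^-1) _ tr.
- exact: trig_cst.
- exact: trigM.
- apply: trigM => //; under eq_fun do rewrite -mulN1r.
  by apply: trigD; [exact: trig_cst|exact: trigZ].
- by rewrite invr_gt0.
(* The first summand dominates [4 L |v i / M - t x|] by Young's inequality, and the second the error
   of the sine. *)
pose a i x := 4 * L * (c / 2 + (v i / M%:R - t x) ^+ 2 / (2 * c))
              + dot x u ^+ 2 / L.
exists I, F, a; split => //.
- by move=> i; split=> //; exists (4^-1 ^+ M) => //; rewrite exprn_gt0.
- move=> i; split; last first.
    have [L0' c0'] := (ltW L0, ltW c0).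
    move=> x; apply: addr_ge0; last by rewrite divr_ge0 ?sqr_ge0.
    apply: mulr_ge0; [exact: mulr_ge0|apply: addr_ge0; first exact: divr_ge0].
    by apply: divr_ge0; [exact: sqr_ge0|exact: mulr_ge0].
  rewrite /a; apply: quadratic_growthD.
    apply/bounded_growth/trig_bounded/trigZ/trigD; first exact: trig_cst.
    rewrite (_ : (fun _ => _) = (fun x => (2 * c)^-1 *
      ((v i / M%:R + (-1) * t x) * (v i / M%:R + (-1) * t x)))).
      by apply/trigZ/trigM; (apply: trigD; [exact: trig_cst|exact: trigZ]).
    by apply/funext => x; rewrite mulN1r mulrC expr2.
  under eq_fun do rewrite mulrC.
  exact/quadratic_growthZ/quadratic_growth_dot_sqr.
(* Both [(x|u)] and [(y|u)] are compared, through their sines, with the common value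
   [4 L v i / M - 2 L] attached to the cell. *)
- move=> _ -> i x y; rewrite dotBl.
  have near_sin z : `|dot z u - L * sin (dot z u / L)| <= dot z u ^+ 2 / L.
    have := ler_norm_Bsin (dot z u / L); rewrite -(ler_pM2l L0).
    rewrite -{1}(gtr0_norm L0) -normrM mulrBr.
    rewrite (_ : L * (_ / L) = dot z u); last by field; rewrite gt_eqF.
    rewrite (_ : L * _ ^+ 2 = dot z u ^+ 2 / L)//; field; rewrite gt_eqF//.
  have near_v z : `|4 * L * (v i / M%:R - t z)| <=
      4 * L * (c / 2 + (v i / M%:R - t z) ^+ 2 / (2 * c)).
    have L2 : 0 < 4 * L by exact: mulr_gt0.
    by rewrite normrM gtr0_norm// ler_pM2l//; exact: le_mean_square.
  have tE z : 4 * L * t z = 2 * L + L * sin (dot z u / L) by rewrite /t; field.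
  have := near_v y; have := near_v x; have := near_sin y; have := near_sin x.
  rewrite /a !ler_norml !(mulrBr (4 * L)) !tE.
  move=> /andP[x1 x2] /andP[y1 y2] /andP[u1 u2] /andP[v1 v2].
  apply/andP; split; lra.
- move=> x.
  have -> : \sum_i F i x * a i x =
      2 * L * c + dot x u ^+ 2 / L + 2 * L / (c * M%:R) * (t x * (1 - t x)).
    rewrite (eq_bigr (fun i => (2 * L * c + dot x u ^+ 2 / L) * F i x +
        2 * L / (c * M%:R ^+ 2) * (F i x * (v i - M%:R * t x) ^+ 2))); last first.
      by move=> i _; rewrite /a; field; rewrite !gt_eqF.
    rewrite big_split/= -!mulr_sumr F1 Fv mulr1; field.
    by rewrite !gt_eqF.
  have /andP[t0 t1] := tr x.
  have h1 : dot x u ^+ 2 / L <= e * `|x| ^+ 2.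
    rewrite ler_pdivrMr// /L mulrC mulrA divfK ?gt_eqF//.
    rewrite (le_trans (sqr_dot_le _ dot_norm _ _))//.
    by rewrite ler_wpM2r ?sqr_ge0// lerDl.
  have h2 : 2 * L / (c * M%:R) * (t x * (1 - t x)) <= e / 2.
    have K0 : 0 < 2 * L / (c * M%:R) by apply: divr_gt0; exact: mulr_gt0.
    have Ke : 2 * L / (c * M%:R) <= e / 2.
      have [ce0 cM0] := (mulr_gt0 c0 e0, mulr_gt0 c0 M0).
      move: BM; rewrite /B (ltr_pdivrMr _ _ ce0) (ler_pdivrMr _ _ cM0).
      rewrite (_ : e / 2 * _ = M%:R * (c * e) / 2); last ring.
      by move=> ?; lra.
    apply: le_trans Ke; rewrite ler_piMr ?ltW//; nra.
  have h3 : 2 * L * c = e / 2 by rewrite /c; field; rewrite gt_eqF.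
  lra.
Qed.

(** Products of cells refine both partitions. The averaged errors add up, because summing out the
    index that an error does not involve gives 1. *)
Lemma localizes_setU (V W : set H) (e1 e2 : R) (I J : finType)
    (F a : I -> H -> R) (G b : J -> H -> R) :
  localizes V e1 I F a -> localizes W e2 J G b ->
  localizes (V `|` W) (e1 + e2) (I * J)%type
    (fun p x => F p.1 x * G p.2 x) (fun p x => a p.1 x + b p.2 x).
Proof.
move=> [FT F1 aQ aV ae] [GT G1 bQ bW be]; split.
- move=> [i j]; have [[? [r r0 Fr]] [? [s s0 Gs]]] := (FT i, GT j).
  split; first exact: trigM.
  by exists (r * s) => [|x]; [exact: mulr_gt0|rewrite ler_pM// ltW].
- move=> x; rewrite -(pair_bigA _ (fun i j => F i x * G j x))/=.
  by under eq_bigr do rewrite -mulr_sumr G1 mulr1; exact: F1.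
- move=> [i j]; have [[? ?] [? ?]] := (aQ i, bQ j).
  by split=> [|x]; [exact: quadratic_growthD|exact: addr_ge0].
- move=> u uVW [i j] x y /=; have [_ a0] := aQ i; have [_ b0] := bQ j.
  case: uVW => [/aV/(_ i x y)|/bW/(_ j x y)] /le_trans; apply.
  + by rewrite addrACA lerDl addr_ge0.
  + by rewrite addrACA lerDr addr_ge0.
- move=> x.
  rewrite -(pair_bigA _ (fun i j => F i x * G j x * (a i x + b j x)))/=.
  rewrite (eq_bigr (fun i => F i x * a i x + F i x * \sum_j G j x * b j x)).
    by rewrite big_split/= -mulr_suml F1 mul1r mulrDl lerD.
  move=> i _; rewrite (eq_bigr (fun j =>
      F i x * a i x * G j x + F i x * (G j x * b j x))); last by move=> *; ring.
  by rewrite big_split/= -!mulr_sumr G1 mulr1.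
Qed.

Lemma localizes_prefix (d : nat -> H) (k : nat) (e : R) : 0 < e ->
  exists (I : finType) (F a : I -> H -> R),
    localizes [set u | exists2 j, (j < k)%N & u = d j] e I F a.
Proof.
elim: k e => [|k IH] e e0.
  exists unit, (fun _ _ => 1), (fun _ _ => 0); split.
  - by move=> _; split; [exact: trig_cst|exists 1].
  - by move=> x; rewrite sumr_const card_unit.
  - by move=> _; split=> //; exact: quadratic_growth_cst.
  - by move=> u [].
  - move=> x; rewrite big1 => [|i _]; last exact: mulr0.
    by rewrite mulr_ge0 ?addr_ge0 ?sqr_ge0// ltW.
have e2 : 0 < e / 2 by exact: divr_gt0.
have [I [F [a Fa]]] := IH _ e2.
have [J [G [b Gb]]] := localizes_vector (d k) _ e2.
have [FG1 FG2 FG3 cov FG4] := localizes_setU _ _ _ _ _ _ _ _ _ _ Fa Gb.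
rewrite (splitr e); exists (I * J)%type.
exists (fun p x => F p.1 x * G p.2 x), (fun p x => a p.1 x + b p.2 x).
split=> //.
move=> u [j + ->]; rewrite ltnS leq_eqVlt => /predU1P[->|jk]; apply: cov.
  by right.
by left; exists j.
Qed.

End trigonometric_functions.

(** * Expectations under Borel probabilities *)

Lemma Rintegral_probability_cst d (T : measurableType d) (R : realType)
  (P : probability T R) (c : R) : \int[P]_(x in setT) c = c.
Proof. by rewrite Rintegral_cst//= probability_setT mulr1. Qed.

Section expectation.
Context {R : realType} {H : completeNormedModType R}.
Implicit Types (mu : probability (borelType H) R) (f g : H -> R).

Lemma borel_open (U : set H) : open U -> measurable (U : set (borelType H)).
Proof. by move=> oU; exact: sub_sigma_algebra. Qed.

Lemma continuous_borel_measurable f : continuous f ->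
  measurable_fun [set: borelType H] (f : borelType H -> R).
Proof.
move=> /continuousP cf; apply: (measurability _ (RGenOpens.measurableE R)).
move=> _ [_ [a [b ->] <-]]; rewrite setTI.
by apply: borel_open; apply: cf; exact: interval_open.
Qed.

Definition mean mu f : R := \int[mu]_(x in [set: borelType H]) f x.

Lemma quadratic_growth_integrable mu f : P2 mu -> quadratic_growth f ->
  mu.-integrable [set: borelType H] (EFin \o f).
Proof.
move=> muP [cf [C fC]].
have i2 : mu.-integrable [set: borelType H]
    (EFin \o (fun x : borelType H => `|(x : H)| ^+ 2)).
  apply/integrableP; split.
    apply/measurable_EFinP.
    by have [c _] := @quadratic_growth_sqr R H; exact: continuous_borel_measurable c.
  apply: le_lt_trans muP; rewrite le_eqVlt; apply/orP; left; apply/eqP.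
  by apply: eq_integral => x _ /=; rewrite ger0_norm ?sqr_ge0.
have iC : mu.-integrable [set: borelType H]
    (EFin \o (fun x : borelType H => C * (1 + `|(x : H)| ^+ 2))).
  rewrite (_ : _ \o _ = (fun x => C%:E * (1%:E + (`|(x : H)| ^+ 2)%:E))%E).
    apply: integrableZl => //; apply: integrableD => //.
    exact: finite_measure_integrable_cst.
  by apply/funext => x /=; rewrite EFinM EFinD.
apply: le_integrable iC => //.
  by apply/measurable_EFinP; exact: continuous_borel_measurable.
move=> x _ /=; rewrite lee_fin (le_trans (fC x))//; exact: ler_norm.
Qed.

Section moments.
Variable mu : probability (borelType H) R.
Hypothesis muP : P2 mu.

Lemma meanE f : quadratic_growth f ->
  (\int[mu]_(x in [set: borelType H]) (f x)%:E = (mean mu f)%:E)%E.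
Proof.
move=> fq; rewrite /mean /Rintegral fineK//.
exact/integrable_fin_num/quadratic_growth_integrable.
Qed.

Lemma meanD f g : quadratic_growth f -> quadratic_growth g ->
  mean mu (fun x => f x + g x) = mean mu f + mean mu g.
Proof. by move=> fq gq; apply: RintegralD => //; exact: quadratic_growth_integrable. Qed.

Lemma meanZ c f : quadratic_growth f -> mean mu (fun x => c * f x) = c * mean mu f.
Proof. by move=> fq; apply: RintegralZl => //; exact: quadratic_growth_integrable. Qed.

Lemma mean_cst c : mean mu (fun=> c) = c.
Proof. exact: Rintegral_probability_cst. Qed.

Lemma le_mean f g : quadratic_growth f -> quadratic_growth g ->
  (forall x, f x <= g x) -> mean mu f <= mean mu g.
Proof.
by move=> fq gq fg; apply: le_Rintegral => //; exact: quadratic_growth_integrable.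
Qed.

Lemma mean_ge0 f : (forall x, 0 <= f x) -> 0 <= mean mu f.
Proof. by move=> f0; exact: Rintegral_ge0. Qed.

Lemma mean_sum (I : finType) (F : I -> H -> R) :
  (forall i, quadratic_growth (F i)) ->
  mean mu (fun x => \sum_i F i x) = \sum_i mean mu (F i).
Proof.
move=> FQ; elim: (index_enum I) => [|i s IHs].
  by under [in LHS]eq_fun do rewrite big_nil; rewrite big_nil mean_cst.
rewrite big_cons -IHs -meanD//; first by under eq_fun do rewrite big_cons.
elim: s {IHs} => [|j s IHs].
  by under eq_fun do rewrite big_nil; exact: quadratic_growth_cst.
by under eq_fun do rewrite big_cons; exact: quadratic_growthD.
Qed.

Lemma norm_mean_le f g : quadratic_growth f -> quadratic_growth g ->
  (forall x, `|f x| <= g x) -> `|mean mu f| <= mean mu g.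
Proof.
move=> fq gq fg; rewrite ler_norml; apply/andP; split.
  rewrite -mulN1r -meanZ//; apply: le_mean => //; first exact: quadratic_growthZ.
  by move=> x; rewrite mulN1r lerNl (le_trans _ (fg x))// -normrN ler_norm.
by apply: le_mean => // x; rewrite (le_trans _ (fg x))// ler_norm.
Qed.

Lemma qerror2E (x : 'I_2 -> H) :
  qerror mu x = (Num.sqrt (mean mu (fun xi =>
    Num.min (`|xi - x ord0| ^+ 2) (`|xi - x (lift ord0 ord0)| ^+ 2))))%:E.
Proof.
rewrite /qerror.
under eq_integral do
  rewrite big_ord_recl big_ord_recl big_ord0 miney -EFin_min.
by rewrite meanE//; apply: quadratic_growth_min; exact: quadratic_growth_sqr_dist.
Qed.

End moments.
End expectation.

(** * From quantization errors to trigonometric functions *)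

Section convergence.
Context {R : realType} {H : completeNormedModType R}.
Context (dot : {dot H for @idfun R}) (dot_norm : is_inner_product dot).
Context (mu_ : nat -> probability (borelType H) R) (mu : probability (borelType H) R).
Context (mu_P : forall n, P2 (mu_ n)) (muP : P2 mu).

Definition mean_cvg (f : H -> R) := mean (mu_ n) f @[n --> \oo] --> mean mu f.

Lemma mean_cvg_cst c : mean_cvg (fun=> c).
Proof.
rewrite /mean_cvg mean_cst; under eq_fun do rewrite mean_cst.
exact: cvg_cst.
Qed.

Lemma mean_cvgD f g : quadratic_growth f -> quadratic_growth g ->
  mean_cvg f -> mean_cvg g -> mean_cvg (fun x => f x + g x).
Proof.
move=> fq gq fc gc; rewrite /mean_cvg meanD//.
under eq_fun do rewrite meanD//.
exact: cvgD.
Qed.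

Lemma mean_cvgZ c f : quadratic_growth f ->
  mean_cvg f -> mean_cvg (fun x => c * f x).
Proof.
move=> fq fc; rewrite /mean_cvg meanZ//.
under eq_fun do rewrite meanZ//.
by apply: cvgM => //; exact: cvg_cst.
Qed.

Lemma mean_dist_le (nu : probability (borelType H) R) (f g : H -> R) (e : R) :
  P2 nu -> quadratic_growth f -> quadratic_growth g ->
  (forall x, `|g x - f x| <= e * (1 + `|x| ^+ 2)) ->
  `|mean nu g - mean nu f| <= e * (1 + mean nu (fun x => `|x| ^+ 2)).
Proof.
move=> nuP fq gq gf.
have sq := @quadratic_growth_sqr R H.
have cq : quadratic_growth (fun _ : H => 1 : R) by exact: quadratic_growth_cst.
rewrite -mulN1r -meanZ// -meanD//; last exact: quadratic_growthZ.
rewrite -[X in _ * (X + _)](mean_cst nu) -meanD// -meanZ//; last first.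
  exact: quadratic_growthD.
apply: norm_mean_le => //.
- by apply: quadratic_growthD => //; exact: quadratic_growthZ.
- by apply: quadratic_growthZ; exact: quadratic_growthD.
- by move=> x; rewrite mulN1r.
Qed.

Hypothesis sqr_cvg : mean_cvg (fun x => `|x| ^+ 2).

(** The error [e (1 + |x|^2)] integrates to [e] times one plus the second moment, which is bounded
    uniformly for large [n] because the second moments converge. *)
Lemma mean_cvg_approx f : quadratic_growth f ->
  (forall e, 0 < e -> exists g, [/\ quadratic_growth g, mean_cvg g &
    forall x, `|g x - f x| <= e * (1 + `|x| ^+ 2)]) ->
  mean_cvg f.
Proof.
move=> fq fg; apply/cvgrPdist_le => /= e e0.
set s := mean mu (fun x => `|x| ^+ 2).
have s0 : 0 <= s by apply: mean_ge0 => x; exact: sqr_ge0.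
(* Eventually one plus the second moment is at most [2 + s], so each of the three parts of the error
   is at most [e / 3]. *)
have d0 : 0 < e / (3 * (2 + s)) by rewrite divr_gt0// mulr_gt0// ltr_pwDl.
have [g [gq gc gf]] := fg _ d0.
have sN : \forall n \near \oo, mean (mu_ n) (fun x => `|x| ^+ 2) <= s + 1.
  near=> n; rewrite -lerBlDl (le_trans (ler_norm _))// distrC; near: n.
  by move/cvgrPdist_le : sqr_cvg; apply.
near=> n.
have h1 := mean_dist_le mu f g _ muP fq gq gf.
have h2 := mean_dist_le (mu_ n) f g _ (mu_P n) fq gq gf.
have h3 : `|mean mu g - mean (mu_ n) g| <= e / 3.
  by near: n; move/cvgrPdist_le : gc; apply; rewrite divr_gt0.
have h4 : e / (3 * (2 + s)) * (1 + s) <= e / 3.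
  rewrite invfM mulrA -[leRHS]mulr1 -mulrA ler_pM2l ?divr_gt0//.
  by rewrite ler_pdivrMl ?ltr_pwDl// mulr1 lerD2r ler1n.
have h5 : e / (3 * (2 + s)) * (1 + mean (mu_ n) (fun x => `|x| ^+ 2)) <= e / 3.
  rewrite invfM mulrA -[leRHS]mulr1 -mulrA ler_pM2l ?divr_gt0//.
  rewrite ler_pdivrMl ?ltr_pwDl// mulr1.
  have : mean (mu_ n) (fun x => `|x| ^+ 2) <= s + 1 by near: n.
  lra.
have -> : mean mu f - mean (mu_ n) f = (mean mu f - mean mu g) +
  (mean mu g - mean (mu_ n) g) + (mean (mu_ n) g - mean (mu_ n) f) by ring.
rewrite (le_trans (ler_normD _ _))// (splitr e).
rewrite (@le_trans _ _ (e / 3 + e / 3 + e / 3))//; last lra.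
rewrite lerD//; last exact: le_trans h5.
rewrite (le_trans (ler_normD _ _))// lerD// distrC; exact: le_trans h4.
Unshelve. all: by end_near. Qed.

Hypothesis hinge_cvg : forall u t, mean_cvg (fun x => Num.max (dot x u - t) 0).

Lemma quadratic_growth_dot u : quadratic_growth (fun x : H => dot x u).
Proof.
split; first exact: continuous_dotl.
exists (1 + `|u| ^+ 2) => x.
have := le_mean_square 1 (dot x u) ltr01; have := sqr_dot_le dot dot_norm x u.
have := sqr_ge0 `|x|; have := sqr_ge0 `|u|; nra.
Qed.

Lemma mean_cvg_hinge_span (g : R -> R) u : hinge_span g ->
  quadratic_growth (fun x : H => g (dot x u)) /\ mean_cvg (fun x => g (dot x u)).
Proof.
elim=> [c|t|g1 g2 _ [q1 c1] _ [q2 c2]|c f _ [q1 c1]].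
- by split; [exact: quadratic_growth_cst|exact: mean_cvg_cst].
- split; last exact: hinge_cvg.
  apply: quadratic_growth_max; last exact: quadratic_growth_cst.
  by apply: quadratic_growthD; [exact: quadratic_growth_dot|exact: quadratic_growth_cst].
- by split; [exact: quadratic_growthD|exact: mean_cvgD].
- by split; [exact: quadratic_growthZ|exact: mean_cvgZ].
Qed.

(** A wave is a bounded 1-Lipschitz function of [(x|u)], hence a limit of hinge combinations in the
    weight [1 + (x|u)^2]; by Cauchy-Schwarz this weight is at most [(1 + |u|^2) (1 + |x|^2)]. *)
Lemma mean_cvg_trigonometric f : trigonometric dot f -> mean_cvg f.
Proof.
have tq g := fun gt => bounded_growth g (trig_bounded dot dot_norm g gt).
elim=> {f} [u c|f g ft fc gt gc|c f ft fc].
- apply: mean_cvg_approx; first exact/tq/trig_wave.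
  move=> e e0; pose e' := e / (1 + `|u| ^+ 2).
  have u1 : 0 < 1 + `|u| ^+ 2 by rewrite ltr_wpDr ?sqr_ge0.
  have e'0 : 0 < e' by rewrite divr_gt0.
  have [||g gS gc] := hinge_approx (fun t => cos (t + c)) e' e'0.
  + by move=> x; exact: cos_max.
  + move=> x y; rewrite (le_trans (ler_norm_cosB _ _))//.
    by rewrite opprD addrACA subrr addr0.
  + have [gq gcv] := mean_cvg_hinge_span g u gS.
    exists (fun x => g (dot x u)); split => // x.
    rewrite (le_trans (gc _))// /e' mulrAC ler_pdivrMr// -mulrA ler_pM2l//.
    have := sqr_dot_le dot dot_norm x u; have := sqr_ge0 `|x|.
    have := sqr_ge0 `|u|; nra.
- by apply: mean_cvgD => //; exact: tq.
- by apply: mean_cvgZ => //; exact: tq.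
Qed.

End convergence.

(** * Hinge integrals recovered from the two-point errors *)

Section quantization_convergence.
Context {R : realType} {H : completeNormedModType R}.
Context (dot : {dot H for @idfun R}) (dot_norm : is_inner_product dot).
Context (mu_ : nat -> probability (borelType H) R) (mu : probability (borelType H) R).
Context (mu_P : forall n, P2 (mu_ n)) (muP : P2 mu).
Hypothesis qerror_cvg :
  forall x : 'I_2 -> H, qerror (mu_ n) x @[n --> \oo] --> qerror mu x.

Lemma mean_cvg_min_sqr_dist a b :
  mean_cvg mu_ mu (fun x => Num.min (`|x - a| ^+ 2) (`|x - b| ^+ 2)).
Proof.
have := qerror_cvg (fun i => if i == ord0 then a else b).
rewrite qerror2E//; under eq_fun do rewrite qerror2E//.
move/fine_cvg => /= c.
pose F x := Num.min (`|x - a| ^+ 2) (`|x - b| ^+ 2).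
have sqrK (nu : probability (borelType H) R) :
    Num.sqrt (mean nu F) * Num.sqrt (mean nu F) = mean nu F.
  by rewrite -expr2 sqr_sqrtr//; apply: mean_ge0 => x; rewrite le_min !sqr_ge0.
rewrite /mean_cvg -/F -(sqrK mu).
rewrite (_ : (fun n => mean (mu_ n) F) =
    (fun n => Num.sqrt (mean (mu_ n) F) * Num.sqrt (mean (mu_ n) F))).
  exact: (cvgM c c).
by apply/funext => n; rewrite sqrK.
Qed.

Lemma mean_cvg_sqr_dist a : mean_cvg mu_ mu (fun x => `|x - a| ^+ 2).
Proof.
have := mean_cvg_min_sqr_dist a a.
by under [X in mean_cvg _ _ X]eq_fun do rewrite minxx.
Qed.

Lemma mean_cvg_hinge u t : mean_cvg mu_ mu (fun x => Num.max (dot x u - t) 0).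
Proof.
have [->|u0] := eqVneq u 0.
  under [X in mean_cvg _ _ X]eq_fun do rewrite dot0r.
  exact: mean_cvg_cst.
have u2 : `|u| ^+ 2 != 0 by rewrite expf_neq0// normr_eq0.
(* The bisecting hyperplane of [a] and [b] is [(x|u) = t], and [b - a = u]. Hence [|x - a|^2]
   exceeds the minimum of the two squared distances by exactly twice the hinge. *)
pose s := t / `|u| ^+ 2; pose a := (s - 2^-1) *: u; pose b := (s + 2^-1) *: u.
rewrite (_ : (fun _ => _) = (fun x => 2^-1 * (`|x - a| ^+ 2 +
    (-1) * Num.min (`|x - a| ^+ 2) (`|x - b| ^+ 2)))); last first.
  apply/funext => x.
  have -> : `|x - b| ^+ 2 = `|x - a| ^+ 2 - 2 * (dot x u - t).
    have tE : t = s * `|u| ^+ 2 by rewrite divfK.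
    rewrite [in RHS]tE /a /b !(sqr_normB dot dot_norm) !normrZ !exprMn.
    by rewrite !(real_normK (num_real _)) !dotZr; field.
  by rewrite /Num.max /Num.min; do 2 case: ifPn; lra.
have q c := @quadratic_growth_sqr_dist R H c.
have qm := quadratic_growth_min _ _ (q a) (q b).
apply: mean_cvgZ => //; first by apply: quadratic_growthD => //; exact: quadratic_growthZ.
apply: mean_cvgD => //; first exact: quadratic_growthZ.
  exact: mean_cvg_sqr_dist.
by apply: mean_cvgZ => //; exact: mean_cvg_min_sqr_dist.
Qed.

Lemma mean_cvg_sqr : mean_cvg mu_ mu (fun x => `|x| ^+ 2).
Proof.
have := mean_cvg_sqr_dist 0.
by under [X in mean_cvg _ _ X]eq_fun do rewrite subr0.
Qed.

End quantization_convergence.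

(** * Couplings defined by a density *)

Section density.
Context d (T : measurableType d) (R : realType) (mu : {measure set T -> \bar R}).
Context (D : T -> R) (mD : measurable_fun setT D) (D0 : forall x, 0 <= D x).

(** The two proofs are arguments so that the measure structure can be attached to the term
    [density mD D0]. *)
Definition density of measurable_fun setT D & (forall x, 0 <= D x) :=
  fun A : set T => (\int[mu]_(x in A) (D x)%:E)%E.

Local Notation nu := (density mD D0).

Let density0 : nu set0 = 0%E.
Proof. exact: integral_set0. Qed.

Let density_ge0 A : (0 <= nu A)%E.
Proof. by apply: integral_ge0 => x _; rewrite lee_fin. Qed.

Let density_sigma_additive : semi_sigma_additive nu.
Proof.
move=> F mF tF mUF; rewrite /density ge0_integral_bigcup//.
- by apply: is_cvg_nneseries => n _ _; exact: density_ge0.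
- by apply/measurable_EFinP/measurable_funTS.
- by move=> x _; rewrite lee_fin.
Qed.

HB.instance Definition _ := isMeasure.Build _ _ _ nu
  density0 density_ge0 density_sigma_additive.

Import HBNNSimple.

Lemma integral_density_nnsfun (h : {nnsfun T >-> R}) :
  (\int[nu]_x (h x)%:E = \int[mu]_x ((h x)%:E * (D x)%:E))%E.
Proof.
have mDE : measurable_fun setT (EFin \o D) by exact/measurable_EFinP.
rewrite integralT_nnsfun sintegralE.
under [RHS]eq_integral => x _.
  rewrite fimfunE -fsumEFin// ge0_mule_fsuml; last first.
    by move=> r; exact: nnfun_muleindic_ge0.
  over.
rewrite ge0_integral_fsum//; last 2 first.
- by move=> r; apply: emeasurable_funM => //; apply/measurable_EFinP/measurable_funM.
- by move=> r x _; rewrite mule_ge0 ?lee_fin//; exact: nnfun_muleindic_ge0.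
apply: eq_fsbigr => r; rewrite inE => -[x _ <-].
have m1 : measurable_fun setT (fun y => ((\1_(h @^-1` [set h x]) y)%:E * (D y)%:E)%E).
  by apply: emeasurable_funM => //; exact/measurable_EFinP.
under eq_integral do rewrite EFinM -muleA.
rewrite ge0_integralZl ?lee_fin//; last by move=> y _; rewrite mule_ge0 ?lee_fin.
congr (_ * _)%E.
transitivity (\int[mu]_(y in h @^-1` [set h x]) (D y)%:E)%E => //.
rewrite integral_mkcond; apply: eq_integral => y _; rewrite patchE indicE.
by case: ifPn; rewrite ?mul1e ?mul0e.
Qed.

(** Monotone convergence on both sides along simple functions increasing to [f]. *)
Lemma integral_density (f : T -> \bar R) :
  measurable_fun setT f -> (forall x, 0 <= f x)%E ->
  (\int[nu]_x f x = \int[mu]_x (f x * (D x)%:E))%E.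
Proof.
move=> mf f0; pose h := nnsfun_approx measurableT mf.
have mDE : measurable_fun setT (EFin \o D) by exact/measurable_EFinP.
have hf x : (h n x)%:E @[n --> \oo] --> f x by exact: cvg_nnsfun_approx.
have nd x a b : (a <= b)%N -> h a x <= h b x.
  by move=> ab; exact/lefP/nd_nnsfun_approx.
have L : (\int[nu]_x (h n x)%:E)%E @[n --> \oo] --> (\int[nu]_x f x)%E.
  rewrite [X in _ --> X](_ : _ = \int[nu]_x limn (fun n => (h n x)%:E))%E.
    apply: cvg_monotone_convergence => //.
    - by move=> n; exact/measurable_EFinP.
    - by move=> n x _; rewrite lee_fin.
    - by move=> x _ a b ab; rewrite lee_fin nd.
  by apply: eq_integral => x _; apply/esym/cvg_lim.
have Rr : (\int[mu]_x ((h n x)%:E * (D x)%:E))%E @[n --> \oo] -->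
    (\int[mu]_x (f x * (D x)%:E))%E.
  rewrite [X in _ --> X](_ : _ =
      \int[mu]_x limn (fun n => (h n x)%:E * (D x)%:E))%E.
    apply: cvg_monotone_convergence => //.
    - by move=> n; apply: emeasurable_funM => //; exact/measurable_EFinP.
    - by move=> n x _; rewrite mule_ge0 ?lee_fin.
    - by move=> x _ a b ab; rewrite lee_wpmul2r ?lee_fin// nd.
  apply: eq_integral => x _; apply/esym/cvg_lim => //.
  exact: cvgeZr.
move: L; under eq_fun do rewrite integral_density_nnsfun.
by move=> L; apply: (cvg_unique _ L Rr).
Qed.

Lemma exists_density_probability : (\int[mu]_x (D x)%:E = 1)%E ->
  exists P : probability T R,
    (forall A, measurable A -> P A = \int[mu]_(x in A) (D x)%:E)%E /\
    (forall f, measurable_fun setT f -> (forall x, 0 <= f x)%E ->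
      \int[P]_x f x = \int[mu]_x (f x * (D x)%:E))%E.
Proof.
move=> D1; pose P : probability T R :=
  HB.pack nu (@Measure_isProbability.Build _ _ _ nu D1).
by exists P; split=> // f mf f0; exact: integral_density.
Qed.

End density.

(** * Couplings with a density and their transport cost *)

Section coupling_by_density.
Context {R : realType} {H : completeNormedModType R}.
Implicit Types (f g : H -> R).

Lemma quadratic_growth_measurable1 f : quadratic_growth f ->
  measurable_fun setT (fun z : borelType H * borelType H => f z.1).
Proof.
move=> [cf _]; apply: (measurableT_comp (f := (f : borelType H -> R))) => //.
exact: continuous_borel_measurable.
Qed.

Lemma quadratic_growth_measurable2 f : quadratic_growth f ->
  measurable_fun setT (fun z : borelType H * borelType H => f z.2).
Proof.
move=> [cf _]; apply: (measurableT_comp (f := (f : borelType H -> R))) => //.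
exact: continuous_borel_measurable.
Qed.

(** Measurability is for the product of the Borel sigma-algebras. By density, [|x - y| < r] holds
    exactly when [|x - d j| + |y - d j| < r] for some [j], which gives a countable union of
    measurable sets. *)
Lemma measurable_dist (d : nat -> H) :
  (forall x e, 0 < e -> exists j, `|x - d j| < e) ->
  measurable_fun setT
    (fun z : borelType H * borelType H => `|(z.1 : H) - (z.2 : H)|).
Proof.
move=> dd; apply: (measurability _ (RGenInftyO.measurableE R)).
move=> _ [_ [r ->] <-]; rewrite setTI.
pose dist j (x : H) := `|x - d j|.
have cd j : continuous (dist j).
  move=> x; apply: (@continuous_comp _ _ _ (fun x => x - d j) Num.norm).
    by apply: cvgB; [exact: cvg_id | exact: cvg_cst].
  exact: norm_continuous.
rewrite (_ : _ @^-1` _ = \bigcup_j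
    ((fun z : borelType H * borelType H => dist j z.1 + dist j z.2) @^-1` `]-oo, r[)).
  apply: bigcupT_measurable => j.
  have mS : measurable_fun setT
      (fun z : borelType H * borelType H => dist j z.1 + dist j z.2).
    by apply: measurable_funD; apply: (measurableT_comp
      (f := (dist j : borelType H -> R))) => //; exact: continuous_borel_measurable.
  by rewrite -[X in measurable X]setTI; apply: mS => //; exact: measurable_itv.
apply/seteqP; split => -[x y] /=.
  rewrite in_itv/= => xyr.
  have e0 : 0 < (r - `|x - y|) / 2 by rewrite divr_gt0// subr_gt0.
  have [j xj] := dd x _ e0.
  exists j => //=; rewrite in_itv/= /dist.
  have := ler_distD x y (d j); rewrite [`|y - x|]distrC.
  by move: xj; rewrite ltr_pdivlMr//; lra.
move=> [j _]; rewrite /= !in_itv/=; apply: le_lt_trans.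
by rewrite /dist [`|y - _|]distrC; exact: ler_distD.
Qed.

Section two_marginals.
Context (nu mu : probability (borelType H) R) (nuP : P2 nu) (muP : P2 mu).

Lemma fubini_mean (S : H -> H -> R) g :
  measurable_fun setT (fun z : borelType H * borelType H => S z.1 z.2) ->
  (forall x y, 0 <= S x y) -> (forall x, quadratic_growth (S x)) ->
  (forall x, mean mu (S x) = g x) -> quadratic_growth g ->
  (\int[nu \x mu]_z (S z.1 z.2)%:E = (mean nu g)%:E)%E.
Proof.
move=> mS S0 Sq Sg gq; rewrite fubini_tonelli1//; last 2 first.
- exact/measurable_EFinP.
- by move=> z; rewrite lee_fin.
rewrite -meanE//; apply: eq_integral => x _.
by rewrite /fubini_F /= meanE// Sg.
Qed.

(** Tonelli in either order: integrating [D] over one variable gives 1, which leaves the other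
    marginal. *)
Lemma coupling_density (D : H -> H -> R) :
  measurable_fun setT (fun z : borelType H * borelType H => D z.1 z.2) ->
  (forall x y, 0 <= D x y) ->
  (forall x, quadratic_growth (D x)) -> (forall y, quadratic_growth (D ^~ y)) ->
  (forall x, mean mu (D x) = 1) -> (forall y, mean nu (D ^~ y) = 1) ->
  exists gamma, coupling nu mu gamma /\
    (forall c : borelType H * borelType H -> \bar R,
      measurable_fun setT c -> (forall z, 0 <= c z)%E ->
      \int[gamma]_z c z = \int[nu \x mu]_z (c z * (D z.1 z.2)%:E))%E.
Proof.
move=> mD D0 D1q D2q D1 D2.
have mDE : measurable_fun setT
    (fun z : borelType H * borelType H => (D z.1 z.2)%:E).
  exact/measurable_EFinP.
have D01 : (\int[nu \x mu]_z (D z.1 z.2)%:E = 1)%E.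
  rewrite (fubini_mean D (fun=> 1))//; last exact: quadratic_growth_cst.
  by rewrite mean_cst.
have [//|gamma [gE gint]] := exists_density_probability _ _ _ (nu \x mu)%E _ mD _ D01.
exists gamma; split=> // A mA; split.
- rewrite gE; last exact: measurableX.
  rewrite integral_mkcond fubini_tonelli1; last 2 first.
  + by apply/(measurable_restrictT _ _).1; [exact: measurableX|exact: measurable_funTS].
  + by move=> z; rewrite patchE; case: ifPn => // _; rewrite lee_fin.
  transitivity (\int[nu]_x (\1_A x)%:E)%E; last by rewrite integral_indic// setIT.
  apply: eq_integral => x _; rewrite /fubini_F.
  rewrite indicE; case: (boolP (x \in A)) => xA.
    transitivity (\int[mu]_y (D x y)%:E)%E; last by rewrite meanE// D1.
    apply: eq_integral => y _; rewrite patchE ifT//.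
    by rewrite inE; split => //=; exact: set_mem.
  rewrite integral0_eq// => y _; rewrite patchE ifF//.
  by apply/negbTE; move: xA; apply: contra; rewrite !inE => -[].
- rewrite gE; last exact: measurableX.
  rewrite integral_mkcond fubini_tonelli2; last 2 first.
  + by apply/(measurable_restrictT _ _).1; [exact: measurableX|exact: measurable_funTS].
  + by move=> z; rewrite patchE; case: ifPn => // _; rewrite lee_fin.
  transitivity (\int[mu]_x (\1_A x)%:E)%E; last by rewrite integral_indic// setIT.
  apply: eq_integral => y _; rewrite /fubini_G.
  rewrite indicE; case: (boolP (y \in A)) => yA.
    transitivity (\int[nu]_x (D x y)%:E)%E; last by rewrite meanE// D2.
    apply: eq_integral => x _; rewrite patchE ifT//.
    by rewrite inE; split => //=; exact: set_mem.
  rewrite integral0_eq// => x _; rewrite patchE ifF//.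
  by apply/negbTE; move: yA; apply: contra; rewrite !inE => -[].
Qed.

Lemma wasserstein2_le (gamma : probability (borelType H * borelType H)%type R)
    (r : R) : coupling nu mu gamma ->
  (\int[gamma]_z ((`|(z.1 : H) - (z.2 : H)| ^+ 2)%R)%:E <= r%:E)%E ->
  (wasserstein2 nu mu <= (Num.sqrt r)%:E)%E.
Proof.
move=> gc gr; have r0 : 0 <= r.
  rewrite -lee_fin (le_trans _ gr)//; apply: integral_ge0 => z _.
  by rewrite lee_fin sqr_ge0.
rewrite -[leRHS]/(sqrte r%:E) lee_sqrt ?lee_fin//.
by apply: le_trans gr; apply: ereal_inf_lbound; exists gamma.
Qed.

Lemma wasserstein2_ge0 : (0 <= wasserstein2 nu mu)%E.
Proof. exact: sqrte_ge0. Qed.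

Context (d : nat -> H) (dense_d : forall x e, 0 < e -> exists j, `|x - d j| < e).

(* On the part of the coupling which comes from the cell [F i], the cost is
   controlled by [a i] and [b i]; the remaining part has the second marginal
   [(1 - lam) mu]. *)
Lemma wasserstein2_partition_le (I : finType) (F a b : I -> H -> R) (lam : R)
    (A B : H -> R) :
  (forall i, bounded_continuous (F i)) -> (forall i x, 0 <= F i x) ->
  (forall x, \sum_i F i x = 1) -> 0 <= lam <= 1 ->
  (forall i, 0 < mean nu (F i)) ->
  (forall i, lam * mean mu (F i) <= mean nu (F i)) ->
  (forall i, quadratic_growth (a i)) -> (forall i x, 0 <= a i x) ->
  (forall i, quadratic_growth (b i)) -> (forall i x, 0 <= b i x) ->
  quadratic_growth A -> (forall x, \sum_i F i x * a i x <= A x) ->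
  quadratic_growth B -> (forall x, \sum_i F i x * b i x <= B x) ->
  (forall i x y, `|x - y| ^+ 2 / 2 + `|y| ^+ 2 <= `|x| ^+ 2 + (a i x + b i y)) ->
  (wasserstein2 nu mu <= (Num.sqrt (2 *
    (mean nu (fun x => `|x| ^+ 2) - mean mu (fun x => `|x| ^+ 2)
     + mean nu A + mean mu B
     + 2 * (1 - lam) * mean mu (fun x => `|x| ^+ 2))))%:E)%E.
Proof.
move=> Fb F0 F1 /andP[lam0 lam1] q0 lampq aq a0 bq b0 Aq FaA Bq FbB cost.
have Fq i : quadratic_growth (F i) by exact: bounded_growth.
have sqrq : quadratic_growth (fun x : H => `|x| ^+ 2) by exact: quadratic_growth_sqr.
set s := mean mu (fun x => `|x| ^+ 2).
(* [p i] and [q i] are the masses of the cell under [mu] and [nu]. The weight satisfies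
   [w i * q i = lam] and, by the comparison of masses, [w i * p i <= 1]. *)
pose p i := mean mu (F i); pose q i := mean nu (F i); pose w i := lam / q i.
have w0 i : 0 <= w i by rewrite divr_ge0// ltW// q0.
have wq i : w i * q i = lam by rewrite divfK// gt_eqF// q0.
have p0 i : 0 <= p i by exact: mean_ge0.
have wp1 i : w i * p i <= 1.
  by rewrite /w mulrAC (ler_pdivrMr _ _ (q0 i)) mul1r; exact: lampq.
have sump : \sum_i p i = 1.
  by rewrite -mean_sum// -[RHS](mean_cst mu); congr mean; exact/funext.
(* The mass still missing from the first marginal. It depends on [x] only, so it contributes a
   multiple of [mu] to the second marginal. *)
pose r x := 1 - \sum_i w i * p i * F i x.
have r0 x : 0 <= r x.
  by rewrite subr_ge0 -[leRHS](F1 x); apply: ler_sum => i _; rewrite ler_piMl.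
have sq (c : I -> R) : quadratic_growth (fun x => \sum_i c i * F i x).
  by apply: quadratic_growth_sum => i; exact: quadratic_growthZ.
have mean_comb (m : probability (borelType H) R) (mP : P2 m) (c : I -> R)
    (G : I -> H -> R) :
    (forall i, quadratic_growth (G i)) ->
    mean m (fun x => \sum_i c i * G i x) = \sum_i c i * mean m (G i).
  move=> Gq; rewrite mean_sum//; last by move=> i; exact: quadratic_growthZ.
  by apply: eq_bigr => i _; rewrite meanZ.
have rq : quadratic_growth r.
  apply: quadratic_growthD; first exact: quadratic_growth_cst.
  by under eq_fun do rewrite -mulN1r; exact/quadratic_growthZ/sq.
have mean_r : mean nu r = 1 - lam.
  rewrite /r; under [X in mean _ X]eq_fun do rewrite -mulN1r.
  rewrite meanD ?mean_cst//; [|exact: quadratic_growth_cst|exact/quadratic_growthZ/sq].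
  rewrite meanZ// mean_comb//; congr (_ + _); rewrite mulN1r; congr (- _).
  rewrite -[RHS]mulr1 -sump mulr_sumr; apply: eq_bigr => i _.
  by rewrite mulrAC wq.
pose D x y := \sum_i w i * F i x * F i y + r x.
have D0 x y : 0 <= D x y.
  apply: addr_ge0 => //; apply: sumr_ge0 => i _.
  by apply: mulr_ge0 => //; exact: mulr_ge0.
have mF1 i : measurable_fun setT (fun z : borelType H * borelType H => F i z.1).
  exact: quadratic_growth_measurable1.
have mF2 i : measurable_fun setT (fun z : borelType H * borelType H => F i z.2).
  exact: quadratic_growth_measurable2.
have mD : measurable_fun setT (fun z : borelType H * borelType H => D z.1 z.2).
  apply: measurable_funD; last exact: quadratic_growth_measurable1.
  apply: measurable_sum => i; apply: measurable_funM => //.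
  exact: measurable_funM.
have D1q x : quadratic_growth (D x).
  by apply: quadratic_growthD; [exact: sq|exact: quadratic_growth_cst].
have D2q y : quadratic_growth (D ^~ y).
  apply: quadratic_growthD => //; under eq_fun do under eq_bigr do rewrite mulrAC.
  exact: sq.
have [x|y|gamma [gc gint]] := coupling_density D mD D0 D1q D2q.
- rewrite (meanD mu muP _ _ (sq _) (quadratic_growth_cst _)) mean_cst mean_comb//.
  by under eq_bigr do rewrite mulrAC; rewrite /r addrC subrK.
- rewrite (_ : D ^~ y = (fun x => \sum_i w i * F i y * F i x + r x)).
    rewrite (meanD nu nuP _ _ (sq _) rq) mean_comb// mean_r.
    under eq_bigr do rewrite mulrAC wq.
    by rewrite -mulr_sumr F1 mulr1 addrC subrK.
  by apply/funext => x; congr (_ + _); apply: eq_bigr => i _; rewrite mulrAC.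
apply: (wasserstein2_le _ _ gc).
(* In [S] the cell terms use the bound [cost], and the remaining part uses
   [|x - y|^2 <= 2 (|x|^2 + |y|^2)]. Each term is a product of a function of [x] and one of [y], so
   the variables integrate separately. *)
pose phi i y := F i y * (b i y - `|y| ^+ 2).
have phiq i : quadratic_growth (phi i).
  apply: quadratic_growthM => //; apply: quadratic_growthD => //.
  by under eq_fun do rewrite -mulN1r; exact: quadratic_growthZ.
pose S x y := \sum_i w i * F i x * ((`|x| ^+ 2 + a i x) * F i y + phi i y)
              + r x * (`|x| ^+ 2 + `|y| ^+ 2).
have half_le x y : `|x - y| ^+ 2 * D x y <= 2 * S x y.
  have h2 : `|x - y| ^+ 2 <= 2 * (`|x| ^+ 2 + `|y| ^+ 2).
    have : `|x - y| ^+ 2 <= (`|x| + `|y|) ^+ 2.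
      by rewrite lerXn2r ?nnegrE ?addr_ge0// ler_normB.
    have := sqr_ge0 (`|x| - `|y|); nra.
  rewrite /D /S [leLHS]mulrDr [leRHS]mulrDr lerD//; last first.
    by rewrite [leLHS]mulrC [leRHS]mulrCA ler_wpM2l.
  rewrite !mulr_sumr; apply: ler_sum => i _.
  rewrite (_ : 2 * _ = w i * F i x * F i y *
      (2 * (`|x| ^+ 2 + (a i x + b i y) - `|y| ^+ 2))); last by rewrite /phi; ring.
  rewrite mulrC ler_wpM2l//.
    by apply: mulr_ge0 => //; exact: mulr_ge0.
  by have := cost i x y; lra.
have S0 x y : 0 <= 2 * S x y.
  by rewrite (le_trans _ (half_le x y))// mulr_ge0// sqr_ge0.
have mS : measurable_fun setT
    (fun z : borelType H * borelType H => 2 * S z.1 z.2).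
  have m1 f := @quadratic_growth_measurable1 f.
  have m2 f := @quadratic_growth_measurable2 f.
  apply: measurable_funM => //; apply: measurable_funD.
    apply: measurable_sum => i; apply: measurable_funM.
      by apply: measurable_funM => //; exact: m1.
    apply: measurable_funD; last exact: m2.
    apply: measurable_funM; last exact: m2.
    by apply: (m1 (fun x => `|x| ^+ 2 + a i x)); exact: quadratic_growthD.
  apply: measurable_funM; first exact: m1.
  apply: measurable_funD; first exact: (m1 (fun x => `|x| ^+ 2)).
  exact: (m2 (fun x => `|x| ^+ 2)).
pose G x i y := (`|x| ^+ 2 + a i x) * F i y + phi i y.
have Gq x i : quadratic_growth (G x i).
  by apply: quadratic_growthD => //; exact: quadratic_growthZ.
have sumGq x : quadratic_growth (fun y => \sum_i w i * F i x * G x i y).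
  by apply: quadratic_growth_sum => i; exact: quadratic_growthZ.
have csq (x : H) : quadratic_growth (fun y : H => `|x| ^+ 2 + `|y| ^+ 2).
  by apply: quadratic_growthD => //; exact: quadratic_growth_cst.
have Sq x : quadratic_growth (S x).
  by apply: quadratic_growthD => //; exact: quadratic_growthZ.
(* The [mu]-integral of [S x]; the terms in [|x|^2] from the cells and from [r] recombine into a
   single [|x|^2]. *)
pose g x := \sum_i w i * p i * (F i x * a i x)
  + \sum_i w i * mean mu (phi i) * F i x + `|x| ^+ 2 + s * r x.
have Sg x : mean mu (S x) = g x.
  rewrite [LHS](meanD mu muP _ _ (sumGq x) (quadratic_growthZ _ _ (csq x))).
  rewrite (mean_comb mu muP _ _ (Gq x)) (meanZ mu muP _ _ (csq x)).
  rewrite (meanD mu muP _ _ (quadratic_growth_cst _) sqrq).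
  rewrite mean_cst -/s.
  rewrite (eq_bigr (fun i => w i * p i * (F i x * a i x) +
     w i * mean mu (phi i) * F i x + `|x| ^+ 2 * (w i * p i * F i x))); last first.
    move=> i _; rewrite (meanD mu muP _ _ (quadratic_growthZ _ _ (Fq i)) (phiq i)).
    by rewrite meanZ// -/(p i); ring.
  by rewrite !big_split/= -mulr_sumr /g /r; ring.
have Faq i : quadratic_growth (fun x => F i x * a i x) by exact: quadratic_growthM.
have Fbq i : quadratic_growth (fun x => F i x * b i x) by exact: quadratic_growthM.
have sumFaq : quadratic_growth (fun x => \sum_i w i * p i * (F i x * a i x)).
  by apply: quadratic_growth_sum => i; exact: quadratic_growthZ.
have gq1 := quadratic_growthD _ _ sumFaq (sq (fun i => w i * mean mu (phi i))).
have gq2 := quadratic_growthD _ _ gq1 sqrq.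
have gq : quadratic_growth g.
  exact: quadratic_growthD _ _ gq2 (quadratic_growthZ _ _ rq).
have mean_g : mean nu g <= mean nu (fun x => `|x| ^+ 2) - s
     + mean nu A + mean mu B + 2 * (1 - lam) * s.
  pose X := mean mu (fun y => \sum_i F i y * b i y).
  have sumFbq : quadratic_growth (fun y => \sum_i F i y * b i y).
    exact: quadratic_growth_sum.
  have X0 : 0 <= X.
    by apply: mean_ge0 => y; apply: sumr_ge0 => i _; exact: mulr_ge0.
  have XB : X <= mean mu B by exact: le_mean.
  have s0 : 0 <= s by apply: mean_ge0 => y; exact: sqr_ge0.
  have sum_phi : \sum_i mean mu (phi i) = X - s.
    rewrite -mean_sum// /X -mulN1r -(meanZ mu muP _ _ sqrq).
    rewrite -(meanD mu muP _ _ sumFbq (quadratic_growthZ _ _ sqrq)).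
    congr mean; apply/funext => y; rewrite mulN1r.
    rewrite (eq_bigr (fun i => F i y * b i y - F i y * `|y| ^+ 2)); last first.
      by move=> i _; rewrite /phi mulrBr.
    by rewrite big_split/= sumrN -mulr_suml F1 mul1r.
  have sumA : \sum_i w i * p i * mean nu (fun x => F i x * a i x) <= mean nu A.
    apply: (@le_trans _ _ (\sum_i mean nu (fun x => F i x * a i x))).
      apply: ler_sum => i _; rewrite ler_piMl//.
      by apply: mean_ge0 => x; exact: mulr_ge0.
    by rewrite -mean_sum//; apply: le_mean => //; exact: quadratic_growth_sum.
  (* The terms in [s] add up to [(1 - 2 lam) s = - s + 2 (1 - lam) s], and [lam X <= X] since [X] is
     nonnegative. *)
  have -> : mean nu g = \sum_i w i * p i * mean nu (fun x => F i x * a i x) +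
      lam * (X - s) + mean nu (fun x => `|x| ^+ 2) + s * (1 - lam).
    rewrite /g (meanD nu nuP _ _ gq2 (quadratic_growthZ _ _ rq)).
    rewrite (meanD nu nuP _ _ gq1 sqrq) (meanD nu nuP _ _ sumFaq (sq _)).
    rewrite (mean_comb nu nuP _ _ Faq) (mean_comb nu nuP _ _ Fq) meanZ// mean_r.
    rewrite -sum_phi mulr_sumr; congr (_ + _ + _ + _).
    by apply: eq_bigr => i _; rewrite mulrAC wq.
  nra.
have mdist := measurable_dist d dense_d.
rewrite gint; last 2 first.
- by apply/measurable_EFinP; exact: measurable_funX.
- by move=> z; rewrite lee_fin sqr_ge0.
apply: (@le_trans _ _ (\int[nu \x mu]_z (2 * S z.1 z.2)%:E)%E).
  apply: ge0_le_integral => //.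
  - by move=> z _; rewrite -EFinM lee_fin mulr_ge0// sqr_ge0.
  - apply: emeasurable_funM => //; last exact/measurable_EFinP.
    by apply/measurable_EFinP; exact: measurable_funX.
  - exact/measurable_EFinP.
  - by move=> z _; rewrite -EFinM lee_fin.
rewrite (fubini_mean (fun x y => 2 * S x y) (fun x => 2 * g x))//.
- by rewrite lee_fin meanZ// ler_pM2l.
- by move=> x; exact: quadratic_growthZ.
- by move=> x; rewrite meanZ// Sg.
- exact: quadratic_growthZ.
Qed.

End two_marginals.
End coupling_by_density.

(** * Convergence in Wasserstein distance *)

Section dense_sequence.
Context {R : realType} {H : completeNormedModType R}.

Lemma separable_dense_sequence : separable H ->
  exists d : nat -> H, forall x e, 0 < e -> exists j, `|x - d j| < e.
Proof.
move=> [D /pfcard_geP[D0|[f]] dD].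
  have [x []] := dD setT (ex_intro _ 0 I) openT.
  by rewrite D0.
exists f => x e e0.
have [y [xy Dy]] := dD (ball x e) (ex_intro _ x (ballxx x e0)) (ball_open _ _).
have [j _ fj] := @surj _ _ _ _ f _ Dy.
by exists j; rewrite fj; move: xy; rewrite -ball_normE.
Qed.

Variable d : nat -> H.

(* The squared distance of [y] to the finite set [0; d 0; ...; d k.-1]. *)
Fixpoint prefix_sqr_dist (k : nat) (y : H) : R :=
  if k is j.+1 then Num.min (prefix_sqr_dist j y) (`|y - d j| ^+ 2)
  else `|y| ^+ 2.

Lemma prefix_sqr_dist_ge0 k y : 0 <= prefix_sqr_dist k y.
Proof. by elim: k => [|k IH] /=; rewrite ?le_min ?sqr_ge0 ?IH. Qed.

Lemma prefix_sqr_dist_le k y : prefix_sqr_dist k y <= `|y| ^+ 2.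
Proof. by elim: k => [|k IH] //=; rewrite ge_min IH. Qed.

Lemma prefix_sqr_dist_le_nth k j y : (j < k)%N ->
  prefix_sqr_dist k y <= `|y - d j| ^+ 2.
Proof.
elim: k => // k IH; rewrite ltnS leq_eqVlt => /predU1P[->|/IH] /=.
  by rewrite ge_min lexx orbT.
by rewrite ge_min => ->.
Qed.

(** Supplies the nearest centre as a vector for the cost bound. The extra centre 0 is harmless
    there, since [dot z 0] vanishes. *)
Lemma prefix_sqr_distP k y : exists2 v,
  v = 0 \/ (exists2 j, (j < k)%N & v = d j) & prefix_sqr_dist k y = `|y - v| ^+ 2.
Proof.
elim: k => [|k [v vk IH]] /=; first by exists 0; [left|rewrite subr0].
rewrite minEle; case: ifPn => _; last by exists (d k) => //; right; exists k.
exists v => //; case: vk => [|[j jk ->]]; [by left|right].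
by exists j => //; rewrite ltnS ltnW.
Qed.

Lemma quadratic_growth_prefix k : quadratic_growth (prefix_sqr_dist k).
Proof.
elim: k => [|k IH] /=; first exact: quadratic_growth_sqr.
by apply: quadratic_growth_min => //; exact: quadratic_growth_sqr_dist.
Qed.

(** Dominated convergence: density gives the pointwise limit 0, and having 0 among the centres gives
    the integrable bound [|y|^2]. *)
Lemma mean_prefix_cvg0 (mu : probability (borelType H) R) : P2 mu ->
  (forall x e, 0 < e -> exists j, `|x - d j| < e) ->
  mean mu (prefix_sqr_dist k) @[k --> \oo] --> 0.
Proof.
move=> muP dd.
have mE k : measurable_fun [set: borelType H]
    (fun y : borelType H => (prefix_sqr_dist k y)%:E).
  apply/measurable_EFinP.
  by have [c _] := quadratic_growth_prefix k; exact: continuous_borel_measurable c.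
have := @dominated_convergence _ _ _ mu setT measurableT
  (fun k (y : borelType H) => (prefix_sqr_dist k y)%:E) (cst 0%E)
  (fun y : borelType H => (`|(y : H)| ^+ 2)%:E) mE (measurable_cst _).
case=> [|||_ _].
- apply: aeW => y _; apply/cvg_EFin; first exact: nearW.
  apply/cvgrPdist_lt => /= e e0.
  have se0 : 0 < Num.min 1 e by rewrite lt_min ltr01.
  have [j yj] := dd y _ se0; exists j.+1 => // k /= jk.
  rewrite sub0r normrN ger0_norm ?prefix_sqr_dist_ge0//.
  rewrite (le_lt_trans (prefix_sqr_dist_le_nth _ _ y jk))//.
  move: yj; rewrite lt_min => /andP[y1 ye]; rewrite expr2.
  by rewrite (le_lt_trans _ ye)// ler_piMl// ltW.
- exact: (quadratic_growth_integrable mu _ muP quadratic_growth_sqr).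
- apply: aeW => y k _ /=.
  by rewrite ger0_norm ?prefix_sqr_dist_ge0// lee_fin prefix_sqr_dist_le.
rewrite integral0 => /fine_cvg /=; exact.
Qed.

End dense_sequence.

Section wasserstein_convergence.
Context {R : realType} {H : completeNormedModType R}.
Context (dot : {dot H for @idfun R}) (dot_norm : is_inner_product dot).
Context (H_separable : separable H).

Lemma qerror2_characterizes_convergence : characterizes_convergence H 2.
Proof.
move=> mu_ mu mu_P muP qc.
have [d dd] := separable_dense_sequence H_separable.
have sqrq : quadratic_growth (fun x : H => `|x| ^+ 2) by exact: quadratic_growth_sqr.
have c2 := mean_cvg_sqr _ _ mu_P muP qc.
have trig_cvg f := mean_cvg_trigonometric dot dot_norm mu_ mu mu_P muP c2
  (mean_cvg_hinge dot dot_norm mu_ mu mu_P muP qc) f.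
set s := mean mu (fun x => `|x| ^+ 2) in c2.
have s0 : 0 <= s by apply: mean_ge0 => x; exact: sqr_ge0.
suff W e : 0 < e -> \forall n \near \oo, (wasserstein2 (mu_ n) mu <= e%:E)%E.
  have fin : \forall n \near \oo, wasserstein2 (mu_ n) mu \is a fin_num.
    near=> n; rewrite ge0_fin_numE ?wasserstein2_ge0//.
    apply: (@le_lt_trans _ _ 1%:E); last exact: ltry.
    by near: n; exact: W.
  apply/fine_cvgP; split=> //; apply/cvgrPdist_le => /= e e0.
  near=> n; rewrite sub0r normrN ger0_norm ?fine_ge0 ?wasserstein2_ge0//.
  rewrite -lee_fin fineK; last by near: n.
  by near: n; exact: W.
(* Under the root the parenthesis is at most [4 t]: [t] for the second moments, [t / 2] for each of
   the two means of [A], [t] for the distance to the centres and [t] for the leftover mass. The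
   factor 2 in front gives [8 t = e^2]. *)
move=> e0; pose t := e ^+ 2 / 8.
have t0 : 0 < t by rewrite divr_gt0// exprn_gt0.
have [k mk] : exists k, mean mu (prefix_sqr_dist d k) <= t / 2.
  have /cvgrPdist_le := mean_prefix_cvg0 d mu muP dd.
  move=> /(_ (t / 2) (divr_gt0 t0 (ltr0n _ 2))) [k _ /(_ k (leqnn k))] /=.
  rewrite sub0r normrN ger0_norm ?mean_ge0//; first by exists k.
  by move=> x; exact: prefix_sqr_dist_ge0.
pose ep := t / (4 * (2 + s)).
have ep0 : 0 < ep by rewrite divr_gt0// mulr_gt0// ltr_pwDl.
have [I [F [a [Ft F1 aq ad ae]]]] := localizes_prefix dot dot_norm d k _ ep0.
(* [kap] is [1 - lam]: the term [t] of the denominator keeps it at most 1, and the other term makes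
   [2 kap s <= t]. *)
pose kap := t / (2 * (1 + s) + t).
have kden : 0 < 2 * (1 + s) + t by rewrite addr_gt0// mulr_gt0// ltr_pwDl.
have kap0 : 0 < kap by exact: divr_gt0.
have kap1 : kap <= 1 by rewrite /kap ler_pdivrMr// mul1r; lra.
have kaps : 2 * kap * s <= t.
  rewrite (_ : _ * s = 2 * t * s / (2 * (1 + s) + t)); last by rewrite /kap; ring.
  by rewrite ler_pdivrMr//; nra.
have Fb i := trig_bounded dot dot_norm _ (Ft i).1.
have F0 i x : 0 <= F i x.
  by have [_ [r r0 Fr]] := Ft i; rewrite (le_trans (ltW r0)).
have mF0 (nu : probability (borelType H) R) i : P2 nu -> 0 < mean nu (F i).
  move=> nuP; have [_ [r r0 Fr]] := Ft i; rewrite (lt_le_trans r0)//.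
  rewrite -[leLHS](mean_cst nu); apply: le_mean => //; first exact: quadratic_growth_cst.
  exact: bounded_growth.
(* Each cell has positive [mu]-mass [p0], which leaves a slack [kap * p0]; since the cells are
   finitely many, one rank serves them all. *)
have Fn : \forall n \near \oo,
    forall i, (1 - kap) * mean mu (F i) <= mean (mu_ n) (F i).
  apply: filter_forall => i; have p0 := mF0 mu i muP.
  near=> n; rewrite mulrBl mul1r lerBlDr -lerBlDl (le_trans (ler_norm _))//.
  near: n; move/cvgrPdist_le : (trig_cvg _ (Ft i).1); apply.
  exact: mulr_gt0.
near=> n.
have hn : mean (mu_ n) (fun x => `|x| ^+ 2) <= s + Num.min t 1.
  rewrite -lerBlDl (le_trans (ler_norm _))// distrC; near: n.
  by move/cvgrPdist_le : c2; apply; rewrite lt_min t0 ltr01.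
have [hn1 hn2] : mean (mu_ n) (fun x => `|x| ^+ 2) <= s + t /\
    mean (mu_ n) (fun x => `|x| ^+ 2) <= s + 1.
  by split; rewrite (le_trans hn)// lerD2l ge_min lexx ?orbT.
(* The factors 2 in [A] and [B] are those of [2 |(x - y|v)|] and [2 |y - v|^2] in the cost bound. *)
pose A (x : H) := 2 * (ep * (1 + `|x| ^+ 2)).
pose B (x : H) := A x + 2 * prefix_sqr_dist d k x.
have oneq : quadratic_growth (fun _ : H => 1 : R) by exact: quadratic_growth_cst.
have Aq : quadratic_growth A.
  by do 2 apply: quadratic_growthZ; exact: quadratic_growthD.
have pq : quadratic_growth (fun x => 2 * prefix_sqr_dist d k x).
  exact/quadratic_growthZ/quadratic_growth_prefix.
have Bq : quadratic_growth B by exact: quadratic_growthD.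
have meanA (nu : probability (borelType H) R) : P2 nu ->
    mean nu A = 2 * (ep * (1 + mean nu (fun x => `|x| ^+ 2))).
  move=> nuP; have q1 := quadratic_growthD _ _ oneq sqrq.
  rewrite (meanZ nu nuP _ _ (quadratic_growthZ _ _ q1)) (meanZ nu nuP _ _ q1).
  by rewrite (meanD nu nuP _ _ oneq sqrq) mean_cst.
have meanB : mean mu B = mean mu A + 2 * mean mu (prefix_sqr_dist d k).
  rewrite (meanD mu muP _ _ Aq pq) meanZ//; exact: quadratic_growth_prefix.
have := wasserstein2_partition_le (mu_ n) mu (mu_P n) muP d dd I F
  (fun i x => 2 * a i x) (fun i x => 2 * a i x + 2 * prefix_sqr_dist d k x)
  (1 - kap) A B Fb F0 F1.
have a0 i x : 0 <= a i x := (aq i).2 x.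
have sumFa x : \sum_i F i x * (2 * a i x) <= A x.
  rewrite (eq_bigr (fun i => 2 * (F i x * a i x))); last by move=> i _; ring.
  by rewrite -mulr_sumr /A ler_pM2l.
move=> W2le; apply: le_trans (W2le _ _ _ _ _ _ _ _ _ _ _ _) _.
- by rewrite subr_ge0 kap1 gerBl ltW.
- by move=> i; exact: mF0.
- by near: n.
- by move=> i; exact/quadratic_growthZ/(aq i).1.
- by move=> i x; rewrite mulr_ge0.
- by move=> i; apply: quadratic_growthD => //; exact/quadratic_growthZ/(aq i).1.
- by move=> i x; rewrite addr_ge0 ?mulr_ge0 ?prefix_sqr_dist_ge0.
- exact: Aq.
- exact: sumFa.
- exact: Bq.
- move=> x; under eq_bigr do rewrite mulrDr.
  by rewrite big_split/= -mulr_suml F1 mul1r lerD2r.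
- move=> i x y; have [v vk vE] := prefix_sqr_distP d k y.
  have := sqr_dist_le dot dot_norm x y v; rewrite -vE.
  have : `|dot (x - y) v| <= a i x + a i y.
    by case: vk => [->|vk]; [rewrite dot0r normr0 addr_ge0|exact: ad].
  lra.
rewrite lee_fin -[leRHS](ger0_norm (ltW e0)) -sqrtr_sqr ler_wsqrtr//.
rewrite -/s meanB !meanA// -/s (_ : 1 - (1 - kap) = kap); last ring.
have -> : e ^+ 2 = 8 * t by rewrite /t; field.
have epE : 4 * (ep * (2 + s)) = t by rewrite /ep; field; rewrite gt_eqF// ltr_pwDl.
nra.
Unshelve. all: by end_near. Qed.

End wasserstein_convergence.

(** * Failure at level 1 *)

Section two_point_measures.
Context {R : realType} {H : completeNormedModType R}.

Lemma exists_two_point (a b : H) (p : R) : 0 <= p <= 1 ->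
  exists P : probability (borelType H) R,
    (forall f : borelType H -> \bar R,
      measurable_fun setT f -> (forall x, 0 <= f x) ->
      \int[P]_x f x = p%:E * f a + (1 - p)%:E * f b)%E.
Proof.
move=> /andP[p0 p1]; have q0 : 0 <= 1 - p by rewrite subr_ge0.
pose da : {measure set (borelType H) -> \bar R} := dirac (a : borelType H).
pose db : {measure set (borelType H) -> \bar R} := dirac (b : borelType H).
pose m : {measure set (borelType H) -> \bar R} :=
  measure_add (mscale (NngNum p0) da) (mscale (NngNum q0) db).
have mint (f : borelType H -> \bar R) : measurable_fun setT f ->
    (forall x, 0 <= f x)%E ->
    (\int[m]_x f x = p%:E * f a + (1 - p)%:E * f b)%E.
  move=> mf f0; rewrite ge0_integral_measure_add//.
  rewrite !ge0_integral_mscale// !integral_dirac//.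
  by rewrite !diracT !mul1e.
have m1 : m setT = 1%E.
  rewrite -[m setT]mul1e -(integral_cst m measurableT 1) mint//.
  by rewrite !mule1 -EFinD addrC subrK.
pose P : probability (borelType H) R :=
  HB.pack (Measure.sort m) (Measure.class m) (Measure_isProbability.Build _ _ _ m m1).
by exists P.
Qed.

(** Two measures on the line spanned by [v], both with mean 0 and second moment [|v|^2]: masses 1/2
    at [v] and [- v], and masses 1/5 at [2 v] and 4/5 at [- v / 2]. Both have squared one-point
    error [|v|^2 + |c|^2] at [c]. *)
Lemma not_characterizes_measures1 (dot : {dot H for @idfun R}) (v : H) :
  is_inner_product dot -> v != 0 -> ~ characterizes_measures H 1.
Proof.
move=> dot_norm v0 char1.
have [|mu muE] := exists_two_point v (- v) 2^-1; first by apply/andP; split; lra.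
have [|nu nuE] := exists_two_point (2 *: v) (- 2^-1 *: v) 5^-1.
  by apply/andP; split; lra.
have msqr c : measurable_fun setT (fun x : borelType H => (`|(x : H) - c| ^+ 2)%:E).
  apply/measurable_EFinP.
  have [cc _] := @quadratic_growth_sqr_dist R H c.
  exact: continuous_borel_measurable cc.
have sqr0 c (x : borelType H) : (0 <= (`|(x : H) - c| ^+ 2)%:E)%E.
  by rewrite lee_fin sqr_ge0.
have qmu (c : H) :
    (\int[mu]_x (`|(x : H) - c| ^+ 2)%:E = (`|v| ^+ 2 + `|c| ^+ 2)%:E)%E.
  rewrite muE// -!EFinM -!EFinD !(sqr_normB dot dot_norm); congr (_%:E).
  by rewrite normrN dotNl; field.
have qnu (c : H) :
    (\int[nu]_x (`|(x : H) - c| ^+ 2)%:E = (`|v| ^+ 2 + `|c| ^+ 2)%:E)%E.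
  rewrite nuE// -!EFinM -!EFinD !(sqr_normB dot dot_norm); congr (_%:E).
  by rewrite !normrZ !dotZl !exprMn !(real_normK (num_real _)); field.
have P2E (m : probability (borelType H) R) :
    (\int[m]_x (`|(x : H) - 0| ^+ 2)%:E = (`|v| ^+ 2 + `|0 : H| ^+ 2)%:E)%E -> P2 m.
  by rewrite /P2; under eq_integral do rewrite subr0; move=> ->; exact: ltry.
have [] := char1 mu nu 0 (P2E _ (qmu 0)) (P2E _ (qnu 0)).
  move=> x; rewrite adde0 /qerror.
  under eq_integral do rewrite big_ord_recl big_ord0 miney.
  under [in RHS]eq_integral do rewrite big_ord_recl big_ord0 miney.
  by rewrite qmu qnu.
move=> munu _.
have vp : 0 < `|v| by rewrite normr_gt0.
(* Among the four atoms this open ball contains only [v], so its masses are 1/2 and 0; [2 v] lies on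
   the boundary. *)
pose V : set (borelType H) := ball v `|v|.
have mB : measurable V.
  by apply: borel_open; exact: ball_open.
have indicE' (m : probability (borelType H) R) :
    m V = (\int[m]_x (\1_V x)%:E)%E.
  by rewrite integral_indic// setIT.
have := munu _ mB; rewrite (indicE' mu) (indicE' nu).
have mI : measurable_fun setT
    (fun x : borelType H => (\1_V x : R)%:E).
  exact/measurable_EFinP/measurable_indic.
have I0 (x : borelType H) : (0 <= (\1_V x : R)%:E)%E by rewrite lee_fin.
rewrite muE// nuE// !indicE.
have inB (t : R) : (t *: v \in V) = (`|1 - t| < 1).
  apply/idP/idP; rewrite inE /V -ball_normE /= -{1}(scale1r v) -scalerBl normrZ.
    by rewrite gtr_pMl.
  by rewrite gtr_pMl.
have -> : v \in V by have := inB 1; rewrite scale1r subrr normr0 ltr01.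
have -> : - v \in V = false.
  have := inB (-1); rewrite scaleN1r => ->; rewrite opprK ger0_norm//.
  by apply/negbTE; rewrite -leNgt; lra.
rewrite !inB (_ : `|1 - 2| < 1 = false); last first.
  by rewrite distrC ger0_norm; [apply/negbTE; rewrite -leNgt; lra|lra].
rewrite (_ : `|1 - (- 2^-1)| < 1 = false); last first.
  by rewrite opprK ger0_norm; [apply/negbTE; rewrite -leNgt; lra|lra].
rewrite !mule0 mule1 !adde0 => -[] /eqP; rewrite invr_eq0; apply/negP.
by rewrite pnatr_eq0.
Qed.

End two_point_measures.

(** * Determination of the measure *)

Section measure_determination.
Context {R : realType} {H : completeNormedModType R}.
Context (dot : {dot H for @idfun R}) (dot_norm : is_inner_product dot).
Context (H_separable : separable H) (H_neq0 : exists x : H, x != 0).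

(** A point of [V k] moved by less than [1 / (k + 1)] stays in [U]. So [nu (V k)] is at most [mu U]
    plus the mass that a coupling moves further, which Markov's inequality makes arbitrarily small;
    and the sets [V k] increase to [U]. *)
Lemma wasserstein2_eq0_le_open (nu mu : probability (borelType H) R) (U : set H) :
  wasserstein2 nu mu = 0%E -> open U -> (nu U <= mu U)%E.
Proof.
move=> W0 oU; have [d dd] := separable_dense_sequence H_separable.
have mdist := measurable_dist d dd.
pose V k : set H := [set x | ball x k.+1%:R^-1 `<=` U].
have mU : measurable (U : set (borelType H)) by exact: borel_open.
have mV k : measurable (V k : set (borelType H)).
  rewrite -[V k]setCK; apply: measurableC; apply: borel_open.
  rewrite (_ : ~` V k = \bigcup_(y in ~` U) ball y k.+1%:R^-1).
    by apply: bigcup_open => y _; exact: ball_open.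
  apply/seteqP; split => x /=.
    by move/existsNP => [y /not_implyP[xy Uy]]; exists y => //; exact: ball_sym.
  by move=> [y Uy yx] xU; apply: Uy; apply: xU; exact: ball_sym.
have Vle k : (nu (V k : set (borelType H)) <= mu (U : set (borelType H)))%E.
  apply/lee_addgt0Pr => e e0; pose r : R := k.+1%:R^-1.
  have r0 : 0 < r by rewrite invr_gt0.
  (* A coupling of cost below [e r^2] gives mass at most [e] to the pairs at distance at least
     [r]. *)
  have er0 : 0 < e * r ^+ 2 by rewrite mulr_gt0// exprn_gt0.
  have [gamma gc gr] : exists2 gamma, coupling nu mu gamma &
      (\int[gamma]_z ((`|(z.1 : H) - (z.2 : H)| ^+ 2)%R)%:E < (e * r ^+ 2)%:E)%E.
    pose S := [set (\int[gamma]_z ((`|(z.1 : H) - (z.2 : H)| ^+ 2)%R)%:E)%E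
      | gamma in coupling nu mu].
    have S0 : (0 <= ereal_inf S)%E.
      apply: le_ereal_inf_tmp => _ [gamma _ <-]; apply: integral_ge0 => z _.
      by rewrite lee_fin sqr_ge0.
    have : (ereal_inf S < (e * r ^+ 2)%:E)%E.
      rewrite -(sqr_sqrte S0) (_ : sqrte _ = 0%E); last exact: W0.
      by rewrite expe2 mule0 lte_fin.
    by move=> /ereal_inf_lt[_ [gamma gc <-] gr]; exists gamma.
  pose F := [set z : borelType H * borelType H | r <= `|(z.1 : H) - (z.2 : H)|].
  have mF : measurable F.
    rewrite -[F]setTI; apply: (mdist measurableT [set t | r <= t]).
    by rewrite -set_itvcy; exact: measurable_itv.
  have gF : (gamma F <= e%:E)%E.
    have r2 : 0 < r ^+ 2 by rewrite exprn_gt0.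
    rewrite -(lee_pmul2r _ (_ : (0 < (r ^+ 2)%:E)%E)) ?lte_fin// -EFinM.
    apply: le_trans (ltW gr); rewrite muleC -integral_cst//.
    rewrite integral_mkcond; apply: ge0_le_integral => //.
    - by move=> z _; rewrite patchE; case: ifPn => // _; rewrite lee_fin ltW.
    - by apply/(measurable_restrictT _ _).1.
    - by apply/measurable_EFinP; exact: measurable_funX.
    - move=> z _; rewrite patchE; case: ifPn => [|_]; last by rewrite lee_fin sqr_ge0.
      by rewrite inE /F /= => rz; rewrite lee_fin lerXn2r ?nnegrE// ltW.
  rewrite -(gc _ (mV k)).1 -(gc _ mU).2.
  apply: le_trans (leeD2l _ gF).
  apply: le_trans (measureU2 _ _ _) => //; last exact: measurableX.
  apply: le_measure; rewrite ?inE//; first exact: measurableX.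
    by apply: measurableU => //; exact: measurableX.
  move=> [x y] /= [Vx _]; have [xy|] := ltP `|x - y| r; last by right.
  by left; split => //; apply: Vx; rewrite -ball_normE.
have VU : \bigcup_k V k = U.
  apply/seteqP; split => x.
    by move=> [k _]; apply; apply: ballxx; rewrite invr_gt0.
  move=> Ux; have /nbhs_ballP[e /= e0 xe] := open_nbhs_nbhs (conj oU Ux).
  have [k ke] : exists k, k.+1%:R^-1 < e.
    exists (Num.bound e^-1); rewrite invf_plt ?posrE//.
    by rewrite (lt_trans (archi_boundP _)) ?invr_ge0 ?(ltW e0)// ltr_nat.
  by exists k => // y xy; apply: xe; exact: le_ball (ltW ke) _ xy.
have nd : nondecreasing_seq V.
  move=> i j ij; apply/subsetPset => x /= Vx; apply: subset_trans Vx.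
  by apply: le_ball; rewrite lef_pV2 ?posrE// ler_nat.
have mVU : measurable (\bigcup_k V k : set (borelType H)) by rewrite VU.
have := nondecreasing_cvg_mu (mu := nu) mV mVU nd.
rewrite VU => cv; rewrite -(cvg_lim _ cv)//.
apply: lime_le; first by apply/cvg_ex; eexists; exact: cv.
exact: nearW.
Qed.

Lemma eq_measure_open (nu mu : probability (borelType H) R) :
  (forall U : set H, open U -> nu U = mu U) -> Defs.eq_measure nu mu.
Proof.
move=> eqU A mA.
have Ifin (k : nat) : (nu (setT : set (borelType H)) < +oo)%E.
  by rewrite -ge0_fin_numE//; exact: fin_num_measure.
apply: (@measure_unique _ _ (borelType H) (@open H) (fun=> setT) _ _ _ _
  nu mu eqU Ifin A mA) => //.
- by move=> U V oU oV; exact: openI.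
- by move=> _; exact: openT.
- by rewrite bigcup_const.
Qed.

(** With both points at [t w], the squared errors are quadratic polynomials [Q] in [t] with the same
    leading coefficient [|w|^2]. Squaring the relation between their roots cancels that
    coefficient. *)
Lemma qerror_eqD_cst0 (mu nu : probability (borelType H) R) (C : R) :
  P2 mu -> P2 nu ->
  (forall x : 'I_2 -> H, qerror mu x = (qerror nu x + C%:E)%E) -> C = 0.
Proof.
move=> muP nuP qE; have [w w0] := H_neq0.
have W0 : 0 < `|w| ^+ 2 by rewrite exprn_gt0// normr_gt0.
have sqrq : quadratic_growth (fun x : H => `|x| ^+ 2) by exact: quadratic_growth_sqr.
have dq := quadratic_growth_dot dot dot_norm w.
have cq := @quadratic_growth_cst R H.
pose s (m : probability (borelType H) R) := mean m (fun x => `|x| ^+ 2).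
pose b (m : probability (borelType H) R) := mean m (dot ^~ w).
pose Q m t := s m - 2 * t * b m + t ^+ 2 * `|w| ^+ 2.
have QE (m : probability (borelType H) R) t : P2 m ->
    mean m (fun x => `|x - t *: w| ^+ 2) = Q m t.
  move=> mP.
  rewrite (_ : (fun _ => _) =
      (fun x => `|x| ^+ 2 + (- (2 * t) * dot x w + t ^+ 2 * `|w| ^+ 2))).
    rewrite meanD//; last by apply: quadratic_growthD => //; exact: quadratic_growthZ.
    rewrite meanD//; last exact: quadratic_growthZ.
    by rewrite meanZ// mean_cst /Q /s /b; ring.
  apply/funext => x; rewrite (sqr_normB dot dot_norm) normrZ exprMn.
  by rewrite (real_normK (num_real _)) dotZr; ring.
have Q0 (m : probability (borelType H) R) t : P2 m -> 0 <= Q m t.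
  by move=> mP; rewrite -QE//; apply: mean_ge0 => x; exact: sqr_ge0.
have sqrtE t : Num.sqrt (Q mu t) = Num.sqrt (Q nu t) + C.
  have := qE (fun=> t *: w); rewrite !qerror2E//.
  under [X in Num.sqrt (mean _ X)]eq_fun do rewrite minxx.
  under [X in (Num.sqrt (mean nu X))%:E]eq_fun do rewrite minxx.
  by rewrite !QE// -EFinD => -[].
(* [2 C sqrt Q] is both affine and of constant sign. *)
pose A := s mu - s nu - C ^+ 2; pose B := - 2 * (b mu - b nu).
have aff t : 2 * C * Num.sqrt (Q nu t) = A + B * t.
  have := sqr_sqrtr (Q0 mu t muP); have := sqr_sqrtr (Q0 nu t nuP).
  rewrite sqrtE /A /B /Q; lra.
apply/eqP; apply: contraT => C0.
have C2 : 0 < C ^+ 2 by rewrite exprn_even_gt0.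
have B0 : B = 0.
  apply/eqP; apply: contraT => B0.
  (* At this [t] the affine function equals [- C], which would force the square root to be
     [- 1/2]. *)
  have := aff (- (A + C) / B); rewrite (_ : A + B * _ = - C); last first.
    by rewrite mulrC divfK//; ring.
  have := sqrtr_ge0 (Q nu (- (A + C) / B)); nra.
have sqr t : 4 * C ^+ 2 * Q nu t = A ^+ 2.
  have := aff t; rewrite B0 mul0r addr0 => <-.
  by rewrite -{1}(sqr_sqrtr (Q0 nu t nuP)); ring.
(* [Q nu] would be constant, but its second difference at -1, 0, 1 is [2 |w|^2 > 0]. *)
have := sqr 0; have := sqr 1; have := sqr (-1); rewrite /Q; nra.
Qed.

Lemma qerror2_characterizes_measures : characterizes_measures H 2.
Proof.
move=> mu nu C muP nuP qE; have C0 := qerror_eqD_cst0 _ _ _ muP nuP qE.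
(* Stated for a generic ordered pair because the comparison on open sets is one-sided and is applied
   in both directions. *)
have W0 (m1 m2 : probability (borelType H) R) : P2 m1 -> P2 m2 ->
    (forall x : 'I_2 -> H, qerror m1 x = qerror m2 x) -> wasserstein2 m1 m2 = 0%E.
  move=> m1P m2P m12.
  have W := qerror2_characterizes_convergence dot dot_norm H_separable
    (fun=> m1) m2 (fun=> m1P) m2P.
  apply: (cvg_unique _ (cvg_cst _) (W _)) => // x.
  by rewrite m12; exact: cvg_cst.
split=> //; apply: eq_measure_open => U oU; apply/eqP; rewrite eq_le.
have qE' (x : 'I_2 -> H) : qerror mu x = qerror nu x by rewrite qE C0 adde0.
by rewrite !wasserstein2_eq0_le_open//; exact: W0.
Qed.

End measure_determination.

Theorem mainTheorem6 (R : realType) (H : completeNormedModType R)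
    (dot : {dot H for @idfun R})
    (dot_norm : is_inner_product dot)
    (H_separable : separable H)
    (H_neq0 : exists x : H, x != 0) :
  is_NH2 H 2.
Proof.
split; first split => //.
- exact: qerror2_characterizes_measures dot_norm H_separable H_neq0.
- exact: qerror2_characterizes_convergence dot_norm H_separable.
(* Level 0 is excluded by the positivity in [admissible_level]; only level 1 needs the
   counterexample. *)
move=> [|[|M]] [] // _ char1 _; have [v v0] := H_neq0.
by have := not_characterizes_measures1 dot v dot_norm v0.
Qed.
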